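(* Let $p\ge1$ and let $W$ and $W'$ be graphons over arbitrary probability spaces with $\|W\|_p,\|W'\|_p<\infty$. The following are equivalent: (i) $\delta_\square(W,W')=0$; (ii) $\delta_p(W,W')=0$; (iii) $W$ and $W'$ are equivalent.
   Context: A graphon over $(\Omega,\mathcal F,\pi)$ is a measurable symmetric $W:\Omega\times\Omega\to[0,\infty)$ with $\|W\|_1<\infty$, $\|W\|_p^p=\int|W|^p\,d\pi\,d\pi$. For graphons $W$ on $(\Omega,\pi)$, $W'$ on $(\Omega',\pi')$: $\delta_p(W,W')=\inf_\nu(\int|W(x,y)-W'(x',y')|^pd\nu(x,x')d\nu(y,y'))^{1/p}$ and $\delta_\square(W,W')=\inf_\nu\sup_{S,T}|\int_{S\times T}(W(x,y)-W'(x',y'))\,d\nu(x,x')\,d\nu(y,y')|$, infima over couplings $\nu$ of $\pi$ and $\pi'$, supremum over measurable $S,T\subseteq\Omega\times\Omega'$. $W$ and $W'$ are equivalent if there exist a probability space $\Omega''$, a graphon $U$ on it, and measure-preserving maps $\phi:\Omega\to\Omega''$, $\phi':\Omega'\to\Omega''$ with $W(x,y)=U(\phi(x),\phi(y))$ and $W'(x,y)=U(\phi'(x),\phi'(y))$ almost everywhere. *)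

(* Defs.v *)
From HB Require Import structures.
From mathcomp Require Import all_boot all_order all_algebra.
From mathcomp Require Import all_classical all_reals all_analysis.
Set Implicit Arguments. Unset Strict Implicit. Unset Printing Implicit Defensive.
Import Order.TTheory GRing.Theory Num.Theory.
Local Open Scope classical_set_scope.
Local Open Scope ring_scope.

Section graphons.
Context {R : realType}.

Definition graphon {d} {T : measurableType d} (P : probability T R)
    (W : T -> T -> R) : Prop :=
  [/\ measurable_fun [set: T * T] (fun z : T * T => W z.1 z.2),
      (forall x y, W x y = W y x),
      (forall x y, 0 <= W x y) &
      (\int[(P \x P)%E]_z (`|W z.1 z.2|)%:E < +oo)%E].

Definition Lp_pow {d} {T : measurableType d} (P : probability T R) (p : R)
    (W : T -> T -> R) : \bar R :=
  (\int[(P \x P)%E]_z (`|W z.1 z.2| `^ p)%:E)%E.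

Definition coupling {d d'} {T : measurableType d} {T' : measurableType d'}
    (P : probability T R) (P' : probability T' R)
    (nu : probability (T * T')%type R) : Prop :=
  (forall A, measurable A -> nu (A `*` [set: T']) = P A) /\
  (forall B, measurable B -> nu ([set: T] `*` B) = P' B).

Definition delta_p {d d'} {T : measurableType d} {T' : measurableType d'}
    (P : probability T R) (P' : probability T' R) (p : R)
    (W : T -> T -> R) (W' : T' -> T' -> R) : \bar R :=
  ereal_inf [set ((\int[(nu \x nu)%E]_z
                     (`|W z.1.1 z.2.1 - W' z.1.2 z.2.2| `^ p)%:E) `^ p^-1)%E
            | nu in [set nu : probability (T * T')%type R | coupling P P' nu]].

Definition delta_cut {d d'} {T : measurableType d} {T' : measurableType d'}
    (P : probability T R) (P' : probability T' R)
    (W : T -> T -> R) (W' : T' -> T' -> R) : \bar R :=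
  ereal_inf [set ereal_sup
     [set e | exists S U : set (T * T')%type, [/\ measurable S, measurable U &
        e = `| \int[(nu \x nu)%E]_(z in S `*` U)
                  (W z.1.1 z.2.1 - W' z.1.2 z.2.2)%:E |%E]]
            | nu in [set nu : probability (T * T')%type R | coupling P P' nu]].

Definition measure_preserving {d d''} {T : measurableType d}
    {T'' : measurableType d''} (P : probability T R) (P'' : probability T'' R)
    (phi : T -> T'') : Prop :=
  measurable_fun [set: T] phi /\
  (forall A, measurable A -> P (phi @^-1` A) = P'' A).

Definition graphon_equiv {d d'} {T : measurableType d} {T' : measurableType d'}
    (P : probability T R) (P' : probability T' R)
    (W : T -> T -> R) (W' : T' -> T' -> R) : Prop :=
  exists (d'' : measure_display) (T'' : measurableType d'')
         (P'' : probability T'' R) (U : T'' -> T'' -> R)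
         (phi : T -> T'') (phi' : T' -> T''),
    [/\ graphon P'' U, measure_preserving P P'' phi,
        measure_preserving P' P'' phi',
        {ae (P \x P)%E, forall z : (T * T)%type, W z.1 z.2 = U (phi z.1) (phi z.2)} &
        {ae (P' \x P')%E, forall z : (T' * T')%type, W' z.1 z.2 = U (phi' z.1) (phi' z.2)}].

End graphons.

(* Main.v *)
(* The cut distance, every L^p distance and the L^1 distance vanish together. For the
   cut distance, approximate both graphons in L^1 by step functions: on a fixed finite
   partition the L^1 norm is controlled by the cut norm. L^1 and L^p are compared by
   truncation.

   From couplings [nu] with [W] and [W'] arbitrarily close in L^1([nu \x nu]) we obtain a
   common factor with neither regular conditional probabilities nor compactness of the
   space of couplings. Fix an ultrafilter on couplings along which the L^1 distance tends
   to 0. The sets [D] of the disjoint union [T + T'] whose traces on [T] and [T'] agree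
   up to [nu]-measure tending to 0 form a sigma-algebra, for which the two injections
   push [P] and [P'] forward to the same probability. For measurable [A], the function
   [x |-> \int_A W(x, y) dP(y)] extends to a function on [T + T'] measurable for this
   sigma-algebra. Averaging [W] in one variable over a fine enough finite partition
   changes it little in L^1. A first averaging over an arbitrary partition shows that
   the partition may be chosen in the new sigma-algebra, and averaging again over such
   a partition approximates [W] by kernels on [T + T']. These approximate [W'] as well,
   and their L^1 limit is the common kernel.

   Conversely, if both graphons factor through [U], a step approximation of [U] yields a
   coupling that is a product within each class of the partition. *)
Require Import Defs.
From HB Require Import structures.
From mathcomp Require Import all_boot all_order all_algebra.
From mathcomp Require Import all_classical all_reals all_analysis.
From mathcomp Require Import measurable_realfun ring lra.
Set Implicit Arguments. Unset Strict Implicit. Unset Printing Implicit Defensive.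
Import Order.TTheory GRing.Theory Num.Theory.
Import numFieldNormedType.Exports.
Import HBSimple.
Local Open Scope classical_set_scope.
Local Open Scope ring_scope.

(** * The L^1 distance as an extended real *)

Section L1_distance.
Context {R : realType} d (T : measurableType d).
Variable mu : {measure set T -> \bar R}.
Implicit Types f g h : T -> R.
Local Open Scope ereal_scope.

(** Extended-real valued: a non-integrable difference is at distance [+oo], so that the triangle
    inequality asks for measurability alone. *)
Definition L1dist f g : \bar R := \int[mu]_x (`|f x - g x|)%:E.

Lemma L1dist_ge0 f g : 0 <= L1dist f g.
Proof. by apply: integral_ge0 => x _; rewrite lee_fin. Qed.

Lemma L1distC f g : L1dist f g = L1dist g f.
Proof. by apply: eq_integral => x _; rewrite distrC. Qed.

Lemma measurable_L1 f g : measurable_fun setT f -> measurable_fun setT g ->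
  measurable_fun setT (fun x => (`|f x - g x|)%:E : \bar R).
Proof.
move=> mf mg; apply/measurable_EFinP.
by apply: measurableT_comp => //; exact: measurable_funB.
Qed.

Lemma le_L1dist (F : T -> \bar R) f g : measurable_fun setT f ->
  measurable_fun setT g -> measurable_fun setT F ->
  (forall x, (`|f x - g x|)%:E <= F x) -> L1dist f g <= \int[mu]_x F x.
Proof.
move=> mf mg mF fgF; apply: ge0_le_integral => //.
exact: measurable_L1.
Qed.

Lemma L1dist_triangle g f h : measurable_fun setT f -> measurable_fun setT g ->
  measurable_fun setT h -> L1dist f h <= L1dist f g + L1dist g h.
Proof.
move=> mf mg mh; rewrite /L1dist -ge0_integralD//.
- apply: le_L1dist => //.
  + by apply: emeasurable_funD; exact: measurable_L1.
  + by move=> x; rewrite -EFinD lee_fin ler_distD.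
- exact: measurable_L1.
- exact: measurable_L1.
Qed.

Lemma L1dist_eq0 f g : measurable_fun setT f -> measurable_fun setT g ->
  L1dist f g = 0 -> {ae mu, forall x, f x = g x}.
Proof.
move=> mf mg fg0.
have /ae_eq_integral_abs : measurable_fun setT (fun x => (f x - g x)%:E : \bar R).
  by apply/measurable_EFinP; exact: measurable_funB.
move=> /(_ mu measurableT)[+ _]; rewrite (_ : \int[mu]_x _ = 0)// => /(_ erefl).
apply: filterS => x /(_ I)/eqP; rewrite eqe subr_eq0 => /eqP.
exact.
Qed.

End L1_distance.

(** * Measure-preserving maps, and couplings through their marginals *)

Section measure_preserving_theory.
Context {R : realType}.
Local Open Scope ereal_scope.

(** The push-forward of the product measure takes the product values on measurable rectangles, and
    these determine a product measure. *)
Lemma measure_preserving_prod d1 d2 d3 d4 (X : measurableType d1)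
  (Y : measurableType d2) (X' : measurableType d3) (Y' : measurableType d4)
  (P : probability X R) (Q : probability Y R)
  (P' : probability X' R) (Q' : probability Y' R) phi psi :
  measure_preserving P P' phi -> measure_preserving Q Q' psi ->
  measure_preserving (P \x Q) (P' \x Q') (fun z => (phi z.1, psi z.2)).
Proof.
move=> [mphi Pphi] [mpsi Qpsi].
have mpp : measurable_fun setT (fun z : X * Y => (phi z.1, psi z.2)).
  apply/measurable_fun_pairP; split.
    exact: (measurableT_comp mphi).
  exact: (measurableT_comp mpsi).
split => // A mA; apply/esym.
have := @product_measure_unique _ _ _ _ _ P' Q'
  (pushforward (P \x Q) (fun z : X * Y => (phi z.1, psi z.2))).
apply => // B C mB mC.
rewrite -[LHS]/((P \x Q) ((phi @^-1` B) `*` (psi @^-1` C))).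
have mB' : measurable (phi @^-1` B) by rewrite -[X in measurable X]setTI; exact: mphi.
have mC' : measurable (psi @^-1` C) by rewrite -[X in measurable X]setTI; exact: mpsi.
by rewrite product_measure1E//= Pphi// Qpsi.
Qed.

Lemma ge0_integral_mp d1 d2 (X : measurableType d1) (Y : measurableType d2)
  (P : probability X R) (Q : probability Y R) phi (f : Y -> \bar R) :
  measure_preserving P Q phi -> measurable_fun setT f -> (forall y, 0 <= f y) ->
  \int[P]_x f (phi x) = \int[Q]_y f y.
Proof.
move=> [mphi Pphi] mf f0.
rewrite -[LHS]/(\int[P]_(x in phi @^-1` setT) (f \o phi) x).
rewrite -ge0_integral_pushforward//; apply: eq_measure_integral => A mA _.
exact: Pphi.
Qed.

Lemma L1dist_mp d1 d2 (X : measurableType d1) (Y : measurableType d2)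
  (P : probability X R) (Q : probability Y R) phi (f g : Y -> R) :
  measure_preserving P Q phi -> measurable_fun setT f -> measurable_fun setT g ->
  L1dist P (f \o phi) (g \o phi) = L1dist Q f g.
Proof.
move=> Pphi mf mg.
rewrite /L1dist -(ge0_integral_mp Pphi)//; exact: measurable_L1.
Qed.

Lemma measure_preserving_id d (X : measurableType d) (P : probability X R) :
  measure_preserving P P id.
Proof. by split. Qed.

(** Recasts a marginal condition as a measure-preserving projection, so that integrals transfer by
    [ge0_integral_mp] and [L1dist_mp]. *)
Lemma coupling_fst d d' (T : measurableType d) (T' : measurableType d')
  (P : probability T R) (P' : probability T' R) (nu : probability (T * T')%type R) :
  coupling P P' nu -> measure_preserving nu P fst.
Proof.
move=> [nu1 _]; split => // A mA; rewrite -nu1//; congr (nu _).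
by apply/seteqP; split => z //= [].
Qed.

Lemma coupling_snd d d' (T : measurableType d) (T' : measurableType d')
  (P : probability T R) (P' : probability T' R) (nu : probability (T * T')%type R) :
  coupling P P' nu -> measure_preserving nu P' snd.
Proof.
move=> [_ nu2]; split => // A mA; rewrite -nu2//; congr (nu _).
by apply/seteqP; split => z //= [].
Qed.

Lemma integral_cst_probability d (X : measurableType d) (Q : probability X R) (r : R) :
  \int[Q]_x r%:E = r%:E.
Proof.
rewrite integral_cst// [X in _ * X](_ : _ = 1) ?mule1//.
exact: probability_setT.
Qed.

End measure_preserving_theory.

(** * Tails of countable unions and finite measurable partitions *)

Lemma ecvg0_lt {R : realType} (u : nat -> \bar R) (e : R) :
  (u n @[n --> \oo] --> 0%E) -> 0 < e -> exists n, (u n < e%:E)%E.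
Proof.
move=> u0 e0; have := u0 _ (@nbhs_open_ereal_lt _ 0 (cst e) e0).
by move=> [n _ /(_ n (leqnn n)) /= un]; exists n.
Qed.

(** Continuity from above: the remainders decrease to the empty set. *)
Lemma bigcup_tail_small {R : realType} d (T : measurableType d)
    (P : probability T R) (F : nat -> set T) (e : R) :
  (forall n, measurable (F n)) -> 0 < e ->
  exists n, (P ((\bigcup_k F k) `\` \big[setU/set0]_(k < n) F k) < e%:E)%E.
Proof.
move=> mF e0.
pose G n := (\bigcup_k F k) `\` \big[setU/set0]_(k < n) F k.
have mG n : measurable (G n).
  by apply: measurableD; [exact: bigcupT_measurable|exact: bigsetU_measurable].
have G0 : \bigcap_n G n = set0.
  apply/seteqP; split => // x Gx.
  have [[k _ Fkx] _] := Gx 0%N I.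
  have [_] := Gx k.+1 I; apply.
  by rewrite -bigcup_mkord; exists k => /=.
have : P (G n) @[n --> \oo] --> P (\bigcap_n G n).
  apply: nonincreasing_cvg_mu => //.
  - by rewrite (le_lt_trans (probability_le1 _ _)) ?ltry.
  - by rewrite G0.
  - move=> n m nm; apply/subsetPset => x [Fx nFx]; split => //.
    by apply: contra_not nFx; apply: subset_bigsetU.
by rewrite G0 measure0 => /ecvg0_lt/(_ e0).
Qed.

Lemma fin_fun2_bound {R : realType} (I J : finType) (c : I -> J -> R) :
  exists2 C, 0 <= C & forall i j, `|c i j| <= C.
Proof.
exists (\sum_i \sum_j `|c i j|); first by apply: sumr_ge0 => i _; exact: sumr_ge0.
move=> i j; rewrite (bigD1 i)//= (bigD1 j)//= -addrA lerDl addr_ge0 ?sumr_ge0// => i' _.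
exact: sumr_ge0.
Qed.

Definition finpart d (T : measurableType d) (I : finType) (a : T -> I) :=
  forall i, measurable (a @^-1` [set i]).

Section finpart_theory.
Context {R : realType} d (T : measurableType d).

Lemma finpart_preimage (I : finType) (a : T -> I) (A : set I) :
  finpart a -> measurable (a @^-1` A).
Proof.
move=> ma; rewrite (_ : _ @^-1` _ = \bigcup_(i in A) a @^-1` [set i]).
  by apply: fin_bigcup_measurable => // i _; exact: ma.
by apply/seteqP; split=> [x Aax|x [i Ai /= ->]]//; exists (a x).
Qed.

Lemma finpart_pair (I J : finType) (a : T -> I) (b : T -> J) :
  finpart a -> finpart b -> finpart (fun x => (a x, b x)).
Proof.
move=> ma mb [i j].
rewrite (_ : _ @^-1` _ = a @^-1` [set i] `&` b @^-1` [set j]).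
  exact: measurableI.
by apply/seteqP; split => x /= [-> ->].
Qed.

Lemma finpart_comp d' (T' : measurableType d') (I : finType) (phi : T' -> T)
  (a : T -> I) : measurable_fun setT phi -> finpart a -> finpart (a \o phi).
Proof.
by move=> mphi ma i; rewrite -[X in measurable X]setTI; exact: mphi (ma i).
Qed.

(** A preimage under a function defined class by class is a finite union of pieces, one per class.
    Step functions and averages get their measurability from this. *)
Lemma measurable_fun_finpart (I : finType) (a : T -> I) (G : I -> T -> R) :
  finpart a -> (forall i, measurable_fun setT (G i)) ->
  measurable_fun setT (fun x => G (a x) x).
Proof.
move=> ma mG _ B mB; rewrite setTI.
rewrite (_ : _ @^-1` _ = \bigcup_(i in setT) (a @^-1` [set i] `&` G i @^-1` B)).
  apply: fin_bigcup_measurable => // i _; apply: measurableI; first exact: ma.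
  by rewrite -[X in measurable X]setTI; exact: mG.
apply/seteqP; split=> [x /= Bx|x [i _ [/= ->]]//].
by exists (a x).
Qed.

Lemma finpart_indic (A : set T) : measurable A -> finpart (fun x => x \in A).
Proof.
move=> mA b; rewrite (_ : _ @^-1` _ = if b then A else ~` A).
  by case: b => //; exact: measurableC.
apply/seteqP; case: b; split=> x /=.
- by move/set_mem.
- by move/mem_set.
- by move/negbT; rewrite notin_setE.
- by move=> nAx; apply/negbTE; rewrite notin_setE.
Qed.

End finpart_theory.

(** The Lipschitz condition of [step_approx_op] for maxima, which express the indicators of finite
    unions. *)
Lemma normr_max_le {R : realType} (x y x' y' : R) :
  `|Num.max x y - Num.max x' y'| <= `|x - x'| + `|y - y'|.
Proof.
by rewrite /Order.max ler_norml; apply/andP; split; case: ltP => ?; case: ltP => ?;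
  case: (ger0P (x - x')) => ?; case: (ger0P (y - y')) => ?; lra.
Qed.

(** * Density in L^1 of step functions on finite grids of rectangles *)

Section step_approximation.
Context {R : realType} d d' (X : measurableType d) (Y : measurableType d').
Variables (P : probability X R) (Q : probability Y R).
Local Notation PQ := (P \x Q)%E.
Implicit Types F G : X * Y -> R.

Definition step_approx F := forall e : R, 0 < e ->
  exists (I J : finType) (a : X -> I) (b : Y -> J) (c : I -> J -> R),
    [/\ finpart a, finpart b &
      (L1dist PQ F (fun z => c (a z.1) (b z.2)) < e%:E)%E].

Lemma measurable_step (I J : finType) (a : X -> I) (b : Y -> J) (c : I -> J -> R) :
  finpart a -> finpart b ->
  measurable_fun setT (fun z : X * Y => c (a z.1) (b z.2)).
Proof.
move=> ma mb.
apply: (@measurable_fun_finpart _ _ _ _ (fun z : X * Y => (a z.1, b z.2))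
  (fun i _ => c i.1 i.2)) => //.
apply: finpart_pair.
  by have := finpart_comp (@measurable_fst _ _ X Y) ma.
by have := finpart_comp (@measurable_snd _ _ X Y) mb.
Qed.

(** The two grids are refined by pairing labels and the operation is applied to the cell values; by
    the Lipschitz condition the errors add up. *)
Lemma step_approx_op (op : R -> R -> R) F G :
  (forall x y x' y', `|op x y - op x' y'| <= `|x - x'| + `|y - y'|) ->
  measurable_fun setT F -> measurable_fun setT G ->
  measurable_fun setT (fun z => op (F z) (G z)) ->
  step_approx F -> step_approx G -> step_approx (fun z => op (F z) (G z)).
Proof.
move=> opL mF mG mop sF sG e e0.
have e2 : 0 < e / 2 by rewrite divr_gt0.
have [I [J [a [b [c [ma mb abc]]]]]] := sF _ e2.
have [I' [J' [a' [b' [c' [ma' mb' abc']]]]]] := sG _ e2.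
exists (I * I')%type, (J * J')%type, (fun x => (a x, a' x)), (fun y => (b y, b' y)),
  (fun i j => op (c i.1 j.1) (c' i.2 j.2)).
have fa := finpart_pair ma ma'; have fb := finpart_pair mb mb'.
have mc := measurable_step c ma mb; have mc' := measurable_step c' ma' mb'.
split => //.
rewrite (splitr e) EFinD; apply: le_lt_trans (lteD abc abc').
rewrite /L1dist -ge0_integralD//=; first last.
- exact: measurable_L1.
- exact: measurable_L1.
apply: le_L1dist => //.
- exact: (measurable_step (fun i j => op (c i.1 j.1) (c' i.2 j.2)) fa fb).
- by apply: emeasurable_funD; exact: measurable_L1.
- by move=> z; rewrite -EFinD lee_fin; exact: opL.
Qed.

Lemma step_approx_lim F : measurable_fun setT F ->
  (forall e : R, 0 < e -> exists G,
    [/\ measurable_fun setT G, step_approx G & (L1dist PQ F G < e%:E)%E]) ->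
  step_approx F.
Proof.
move=> mF h e e0; have e2 : 0 < e / 2 by rewrite divr_gt0.
have [G [mG sG FG]] := h _ e2.
have [I [J [a [b [c [ma mb abc]]]]]] := sG _ e2.
exists I, J, a, b, c; split => //.
rewrite (splitr e) EFinD; apply: le_lt_trans (lteD FG abc).
by apply: L1dist_triangle => //; exact: measurable_step c ma mb.
Qed.

Lemma step_approx_cst (r : R) : step_approx (cst r).
Proof.
move=> e e0; exists unit, unit, (cst tt), (cst tt), (fun _ _ => r); split.
- by move=> i; rewrite preimage_cst; case: ifP.
- by move=> i; rewrite preimage_cst; case: ifP.
- rewrite /L1dist (eq_integral (cst 0%E)) ?integral0 ?lte_fin//.
  by move=> z _ /=; rewrite subrr normr0.
Qed.

Lemma step_approx_scale (r : R) F : measurable_fun setT F -> step_approx F ->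
  step_approx (fun z => r * F z).
Proof.
move=> mF sF e e0.
(* The [+ 1] keeps the divisor positive when [r] is 0. *)
have r0 : 0 < `|r| + 1 by rewrite ltr_wpDl.
have er : 0 < e / (`|r| + 1) by rewrite divr_gt0.
have [I [J [a [b [c [ma mb abc]]]]]] := sF _ er.
exists I, J, a, b, (fun i j => r * c i j); split => //.
have mc := measurable_step c ma mb.
have -> : e%:E = ((`|r| + 1)%:E * (e / (`|r| + 1))%:E)%E.
  by rewrite -EFinM mulrC divfK// gt_eqF.
apply: le_lt_trans (_ : ((`|r| + 1)%:E * L1dist PQ F (fun z => c (a z.1) (b z.2)) < _)%E).
  have r0' : (0 <= (`|r| + 1)%:E :> \bar R)%E by rewrite lee_fin ltW.
  rewrite /L1dist -ge0_integralZl//; last exact: measurable_L1.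
  apply: le_L1dist.
  - exact: measurable_funM.
  - exact: (measurable_step (fun i j => r * c i j) ma mb).
  - apply: measurable_funeM; exact: measurable_L1.
  - by move=> z; rewrite -mulrBr normrM -EFinM lee_fin ler_wpM2r// lerDl.
by rewrite lte_pmul2l.
Qed.

(** Dynkin induction from rectangles. Complements are [1 - x]; a countable disjoint union is cut
    down to a finite one with small remainder, and finite unions are maxima. *)
Lemma step_approx_indic (E : set (X * Y)) : measurable E -> step_approx (\1_E).
Proof.
have m1 (A : set (X * Y)) : measurable A -> measurable_fun setT (\1_A : _ -> R).
  by move=> mA; exact: measurable_indic.
move=> mE; apply: (@dynkin_induction _ (X * Y)%type
  [set A `*` B | A in measurable & B in measurable]
  (fun E => measurable E -> step_approx \1_E)) => //.
- exact: measurable_prod_measurableType.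
- move=> _ _ [A mA [B mB <-]] [A' mA' [B' mB' <-]]; rewrite -setXI.
  by exists (A `&` A'); [exact: measurableI|exists (B `&` B') => //; exact: measurableI].
- by move=> _; rewrite indicT; exact: step_approx_cst.
- move=> _ [A mA [B mB <-]] _ e e0.
  exists bool, bool, (fun x => x \in A), (fun x => x \in B), (fun i j => (i && j)%:R).
  split; [exact: finpart_indic|exact: finpart_indic|].
  rewrite /L1dist (eq_integral (cst 0%E)) ?integral0 ?lte_fin//.
  move=> z _ /=; rewrite indicE (_ : (z \in A `*` B) = (z.1 \in A) && (z.2 \in B)).
    by rewrite subrr normr0.
  apply/idP/andP => [/set_mem[/mem_set ? /mem_set ?]//|[/set_mem ? /set_mem ?]].
  exact: mem_set.
- move=> S mS sS _.
  have -> : \1_(~` S) = (fun z => 1 - \1_S z) :> (X * Y -> R).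
    by apply/funext => z; rewrite !indicE in_setC; case: (z \in S); rewrite /= ?subrr ?subr0.
  (* Subtraction from 1 is read as a binary operation constant in its second argument. *)
  apply: (step_approx_op (op := fun x _ => 1 - x) (G := \1_S)) => //.
  + by move=> x y x' y'; rewrite opprB addrC subrKA distrC lerDl.
  + by apply: measurable_funB => //; exact: (m1 _ mS).
  + exact: sS.
  + exact: sS.
- move=> F mF tF sF mUF; apply: step_approx_lim; first exact: m1.
  move=> e e0; have [n Pn] := bigcup_tail_small PQ mF e0.
  exists (\1_(\big[setU/set0]_(k < n) F k)); split.
  + by apply: m1; exact: bigsetU_measurable.
  + elim: n {Pn} => [|n IH].
      by rewrite big_ord0 indic0; exact: step_approx_cst.
    rewrite big_ord_recr/=; set A := \big[_/_]_(_ < _) _ in IH *.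
    have mA : measurable A by exact: bigsetU_measurable.
    have -> : \1_(A `|` F n) = (fun z => Num.max (\1_A z) (\1_(F n) z)) :> (X * Y -> R).
      apply/funext => z; rewrite !indicE in_setU.
      by case: (z \in A); case: (z \in F n) => /=; rewrite /Order.max ?ltxx ?ltr01// ltr10.
    apply: (step_approx_op (op := Num.max)) => //.
    * exact: normr_max_le.
    * by apply: measurable_maxr; exact: m1.
    * exact: sF.
  + apply: le_lt_trans Pn; set A := \big[_/_]_(_ < _) _.
    have mA : measurable A by exact: bigsetU_measurable.
    have mD : measurable (\bigcup_k F k `\` A) by exact: measurableD.
    apply: (@le_trans _ _ (\int[PQ]_z (\1_(\bigcup_k F k `\` A) z)%:E)%E); last first.
      by rewrite integral_indic// setIT.
    apply: le_L1dist.
    * exact: m1.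
    * exact: m1.
    * by apply/measurable_EFinP; exact: m1.
    * move=> z; rewrite lee_fin !indicE in_setD.
      have : z \in A -> z \in \bigcup_k F k.
        rewrite !inE => Az; move: Az; rewrite /A -bigcup_mkord => -[k _ Fk].
        by exists k.
      case: (z \in A) => /= [->//|_]; first by rewrite subrr normr0.
      by case: (z \in _); rewrite /= subr0 ?normr1 ?normr0.
- by rewrite -measurable_prod_measurableType.
Qed.

(** Integrable functions are L^1 limits of simple functions, and these are finite linear
    combinations of indicators. *)
Lemma step_approxP F : PQ.-integrable setT (EFin \o F) -> step_approx F.
Proof.
move=> iF.
have mF : measurable_fun setT F by apply/measurable_EFinP; exact: measurable_int iF.
apply: step_approx_lim => // e e0.
have [G_ [iG _ GF]] := approximation_sfun_integrable measurableT iF.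
have [n Fn] := ecvg0_lt GF e0.
exists (G_ n); split => //.
rewrite (_ : (G_ n : _ -> R) =
  (fun z => \sum_(y <- finmap.enum_fset (fset_set (range (G_ n)))) (y * \1_(G_ n @^-1` [set y]) z))); last first.
  by apply/funext => z; rewrite fimfunE fsbig_finite.
elim: (finmap.enum_fset _) => [|y s IH].
  rewrite (_ : (fun _ => _) = cst 0); first exact: step_approx_cst.
  by apply/funext => z; rewrite big_nil.
have mi (y' : R) : measurable (G_ n @^-1` [set y']) by exact: measurable_sfunP.
have mm (y' : R) : measurable_fun setT (fun z => y' * \1_(G_ n @^-1` [set y']) z).
  by apply: measurable_funM => //; exact: measurable_indic.
under eq_fun do rewrite big_cons.
apply: step_approx_op => //.
- by move=> x x' z z'; rewrite opprD addrACA ler_normD.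
- by apply: measurable_sum => y'; exact: mm.
- by apply: measurable_funD => //; apply: measurable_sum => y'; exact: mm.
- apply: step_approx_scale; first exact: measurable_indic.
  by apply: step_approx_indic.
Qed.

End step_approximation.

(** * Completeness of L^1 *)

Section L1_completeness.
Context {R : realType} d (T : measurableType d).
Variable mu : {measure set T -> \bar R}.

Lemma dist_le_series (u : nat -> R) (n m : nat) :
  (`|u n - u (n + m)%N|%:E <=
    \sum_(0 <= k <oo) `|u (n + k)%N - u (n + k).+1|%:E)%E.
Proof.
apply: (@le_trans _ _ (\sum_(0 <= k < m) `|u (n + k)%N - u (n + k).+1|%:E)%E).
  elim: m => [|m IH]; first by rewrite big_nil addn0 subrr normr0.
  rewrite big_nat_recr//= addnS; apply: le_trans (leeD IH (lexx _)).
  by rewrite -EFinD lee_fin ler_distD.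
by apply: nneseries_lim_ge => k _ _; rewrite lee_fin.
Qed.

(** If the series has a finite sum, every [u m] with [n <= m] lies within that sum of [u n], hence
    so does the upper limit, which is then finite. *)
Lemma dist_fine_limn_esup (u : nat -> R) (n : nat) :
  (`|u n - fine (limn_esup (EFin \o u))|%:E <=
    \sum_(0 <= k <oo) `|u (n + k)%N - u (n + k).+1|%:E)%E.
Proof.
set S := (X in (_ <= X)%E).
have S0 : (0 <= S)%E by apply: nneseries_ge0 => k _ _; rewrite lee_fin.
have [->|Soo] := eqVneq S +oo%E; first by rewrite leey.
have Sfin : S \is a fin_num by rewrite ge0_fin_numE// ltey.
have /fineK SE := Sfin; rewrite -SE lee_fin.
have bnd m : (n <= m)%N -> u n - fine S <= u m <= u n + fine S.
  move=> nm; have := dist_le_series u n (m - n); rewrite -/S subnKC// -SE lee_fin.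
  by rewrite ler_norml; lra.
have ub : (limn_esup (EFin \o u) <= (u n + fine S)%:E)%E.
  rewrite limn_esup_lim; apply: lime_le; first exact: is_cvg_esups.
  exists n => // m /= nm; apply: ge_ereal_sup => _ [k /= mk <-].
  by rewrite lee_fin; have /andP[] := bnd k (leq_trans nm mk).
have lb : ((u n - fine S)%:E <= limn_esup (EFin \o u))%E.
  rewrite limn_esup_lim; apply: lime_ge; first exact: is_cvg_esups.
  exists n => // m /= nm; apply: (@le_trans _ _ (u m)%:E).
    by rewrite lee_fin; have /andP[] := bnd m nm.
  by apply: ereal_sup_ubound; exists m => /=.
have lfin : limn_esup (EFin \o u) \is a fin_num.
  by rewrite fin_numElt (lt_le_trans _ lb) ?ltNyr// (le_lt_trans ub) ?ltry.
move: ub lb; rewrite -(fineK lfin) !lee_fin ler_norml; lra.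
Qed.

(** The limit is the pointwise upper limit, which always exists and is measurable. Its distance to
    [f n] is bounded by the series of consecutive distances, integrated term by term. *)
Lemma L1_fast_cvg (f : nat -> T -> R) :
  (forall n, measurable_fun setT (f n)) ->
  (forall n, L1dist mu (f n) (f n.+1) <= (2 ^- n.+1)%:E)%E ->
  exists F, measurable_fun setT F /\ forall n, (L1dist mu (f n) F <= (2 ^- n)%:E)%E.
Proof.
move=> mf fast; pose F x := fine (limn_esup (EFin \o f^~ x)).
have mF : measurable_fun setT F.
  apply: (@measurableT_comp _ _ _ _ _ _ fine); first exact: fine_measurable.
  by apply: measurable_fun_limn_esup => n; exact/measurable_EFinP.
exists F; split => // n.
have md k : measurable_fun setT (fun x => `|f (n + k)%N x - f (n + k).+1 x|%:E).
  exact: measurable_L1.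
apply: (@le_trans _ _
    (\int[mu]_x \sum_(0 <= k <oo) `|f (n + k)%N x - f (n + k).+1 x|%:E)%E).
  apply: le_L1dist => //.
    by apply: ge0_emeasurable_sum => // k x _ _; rewrite lee_fin.
  by move=> x; exact: (dist_fine_limn_esup (f^~ x)).
rewrite integral_nneseries//.
apply: (@le_trans _ _
    (\sum_(0 <= k <oo) (0 + (2 ^- n / (2 ^ k.+1)%:R)%:E))%E).
  apply: lee_nneseries => [k _ _|k _]; first exact: L1dist_ge0.
  rewrite add0e; apply: le_trans (fast _) _.
  by rewrite lee_fin natrX -invfM -exprD addnS.
have e0 : 0 <= 2 ^- n :> R by rewrite invr_ge0 exprn_ge0.
(* The geometric series with terms [2 ^- n / 2 ^ k.+1], added to the zero sequence. *)
apply: le_trans (@epsilon_trick R (fun=> 0%E) (2 ^- n) xpredT _ e0) _ => //.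
by rewrite eseries0// add0e.
Qed.

(** [Phi e f] reads: [f] is admissible with error [e]. Admissibility need not pass to the limit, so
    the conclusion provides, near [F], an admissible function with error below [e]. *)
Lemma L1_complete (Phi : R -> (T -> R) -> Prop) :
  (forall e, 0 < e -> exists2 f, measurable_fun setT f & Phi e f) ->
  (forall e e' f f', Phi e f -> Phi e' f' -> (L1dist mu f f' <= (e + e')%:E)%E) ->
  exists2 F, measurable_fun setT F & forall e, 0 < e ->
    exists f e', [/\ measurable_fun setT f, e' < e, Phi e' f &
      (L1dist mu f F < e%:E)%E].
Proof.
move=> exPhi cauchy.
(* With errors [2 ^- n.+2], consecutive choices are within [2 ^- n.+2 + 2 ^- n.+3], below the
   [2 ^- n.+1] that [L1_fast_cvg] asks for. *)
have e0 n : 0 < 2 ^- n.+2 :> R by rewrite invr_gt0 exprn_gt0.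
pose f n := sval (cid2 (exPhi _ (e0 n))).
have mf n : measurable_fun setT (f n) by rewrite /f; case: cid2.
have Pf n : Phi (2 ^- n.+2) (f n) by rewrite /f; case: cid2.
have [F [mF fF]] : exists F, measurable_fun setT F /\
    forall n, (L1dist mu (f n) F <= (2 ^- n)%:E)%E.
  apply: L1_fast_cvg => // n; apply: le_trans (cauchy _ _ _ _ (Pf n) (Pf n.+1)) _.
  rewrite lee_fin (_ : 2 ^- n.+3 = 2 ^- n.+2 / 2); last by rewrite exprSr invfM.
  rewrite (_ : 2 ^- n.+1 = 2 ^- n.+2 * 2); last first.
    by rewrite (exprSr _ n.+1) invfM divfK.
  by have := e0 n; lra.
exists F => // e ep.
have [n ne] : exists n, 2 ^- n < e :> R.
  have := @cvg_geometric R 1 2^-1 _; rewrite ger0_norm ?invr_ge0// invf_lt1// ltr1n.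
  move=> /(_ erefl)/cvgrPdist_lt/(_ _ ep)[n _ /(_ n (leqnn n))].
  by rewrite /geometric/= mul1r sub0r normrN exprVn ger0_norm ?invr_ge0// => ?; exists n.
exists (f n), (2 ^- n.+2); split => //; last by rewrite (le_lt_trans (fF n)).
apply: le_lt_trans ne; rewrite lef_pV2 ?posrE ?exprn_gt0//.
by rewrite ler_weXn2l// ?ler1n// ltnW.
Qed.

End L1_completeness.

(** * Averaging over a finite partition in one variable *)

Section averaging.
Context {R : realType} d d' (X : measurableType d) (Y : measurableType d').
Variables (P : probability X R) (Q : probability Y R).
Local Open Scope ereal_scope.

(** When [Q B] is nonzero and the right side finite, the left side is the absolute value of the
    integral of [g - t] over [B]. *)
Lemma average_block (g : Y -> R) (B : set Y) (t : R) :
  measurable_fun setT g -> measurable B ->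
  `|fine (\int[Q]_y (g y * \1_B y)%:E) / fine (Q B) - t|%:E * Q B <=
    \int[Q]_y (`|g y - t| * \1_B y)%:E.
Proof.
move=> mg mB; have QB : Q B = (fine (Q B))%:E by rewrite fineK// fin_num_measure.
have m1 : measurable_fun setT (\1_B : Y -> R) by exact: measurable_indic.
set r := fine (Q B) in QB *; set RHS := (X in _ <= X).
have RHS0 : 0 <= RHS by apply: integral_ge0 => y _; rewrite lee_fin mulr_ge0.
rewrite QB; have [->|r0] := eqVneq r 0%R; first by rewrite mule0.
have [->|RHSoo] := eqVneq RHS +oo; first by rewrite leey.
have ih : Q.-integrable setT (fun y => ((g y - t) * \1_B y)%:E).
  apply/integrableP; split.
    by apply/measurable_EFinP; apply: measurable_funM => //; exact: measurable_funB.
  rewrite (_ : \int[_]_x _ = RHS) ?ltey//; apply: eq_integral => y _ /=.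
  by rewrite normrM [X in (_ * X)%R]ger0_norm.
have it : Q.-integrable setT (fun y => (t * \1_B y)%:E).
  apply: (@integrableZl _ _ _ Q setT measurableT t (fun y => (\1_B y)%:E)).
  by apply: integrable_indic => //; rewrite -ge0_fin_numE// fin_num_measure.
have -> : \int[Q]_y (g y * \1_B y)%:E =
    \int[Q]_y ((g y - t) * \1_B y)%:E + (t * r)%:E.
  rewrite (_ : (t * r)%:E = \int[Q]_y (t * \1_B y)%:E).
    rewrite -integralD//; apply: eq_integral => y _ /=.
    by rewrite -EFinD -mulrDl subrK.
  under eq_integral do rewrite EFinM.
  rewrite integralZl//; last first.
    by apply: integrable_indic => //; rewrite -ge0_fin_numE// fin_num_measure.
  by rewrite integral_indic// setIT EFinM -QB.
have hfin := integrable_fin_num measurableT ih.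
rewrite -(fineK hfin) -EFinD /= mulrDl mulfK// addrK.
rewrite -EFinM normrM -mulrA (ger0_norm (_ : 0 <= r^-1)%R) ?invr_ge0 ?fine_ge0//.
rewrite mulVf// mulr1 -abse_EFin fineK//.
apply: le_trans (le_abse_integral _ measurableT (measurable_int _ ih)) _.
rewrite le_eqVlt; apply/orP; left; apply/eqP; apply: eq_integral => y _ /=.
by rewrite normrM [X in (_ * X)%R]ger0_norm.
Qed.

(** [fine] sends an infinite integral to 0; for integrable [W] this concerns only a null set of
    [x]. *)
Definition slice (W : X * Y -> R) (B : set Y) (x : X) : R :=
  fine (\int[Q]_y (W (x, y) * \1_B y)%:E).

(** The conditional expectation of [W] given the first variable and the class of the second. On
    classes of measure zero the division yields 0. *)
Definition average (J : finType) (b : Y -> J) (W : X * Y -> R) (z : X * Y) : R :=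
  (slice W (b @^-1` [set b z.2]) z.1 / fine (Q (b @^-1` [set b z.2])))%R.

Lemma measurable_slice (W : X * Y -> R) (B : set Y) :
  measurable_fun setT W -> (forall z, 0 <= W z)%R -> measurable B ->
  measurable_fun setT (slice W B).
Proof.
move=> mW W0 mB.
apply: (@measurableT_comp _ _ _ _ _ _ fine); first exact: fine_measurable.
apply: (@measurable_fun_fubini_tonelli_F _ _ _ _ _ Q
  (fun z => (W z * \1_B z.2)%:E)).
  apply/measurable_EFinP; apply: measurable_funM => //.
  have m1 : measurable_fun setT (\1_B : Y -> R) by exact: measurable_indic.
  exact: (measurableT_comp m1 measurable_snd).
by move=> z; rewrite lee_fin mulr_ge0.
Qed.

Lemma measurable_average (J : finType) (b : Y -> J) (W : X * Y -> R) :
  finpart b -> measurable_fun setT W -> (forall z, 0 <= W z)%R ->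
  measurable_fun setT (average b W).
Proof.
move=> mb mW W0.
have mb2 : finpart (fun z : X * Y => b z.2).
  by have := finpart_comp (@measurable_snd _ _ X Y) mb.
apply: (@measurable_fun_finpart _ _ _ _ _ (fun j (z : X * Y) =>
  (slice W (b @^-1` [set j]) z.1 / fine (Q (b @^-1` [set j])))%R) mb2) => j.
apply: measurable_funM => //.
exact: (measurableT_comp (measurable_slice mW W0 (mb j)) measurable_fst).
Qed.

Lemma integral_finpart (J : finType) (b : Y -> J) (G : J -> Y -> R) :
  finpart b -> (forall j, measurable_fun setT (G j)) -> (forall j y, 0 <= G j y)%R ->
  \int[Q]_y (G (b y) y)%:E =
    \sum_(j : J) \int[Q]_y (G j y * \1_(b @^-1` [set j]) y)%:E.
Proof.
move=> mb mG G0.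
have m1 j : measurable_fun setT (\1_(b @^-1` [set j]) : Y -> R).
  by apply: measurable_indic; exact: mb.
rewrite -(@ge0_integral_sum _ _ _ Q setT measurableT J
  (fun j y => (G j y * \1_(b @^-1` [set j]) y)%:E)).
- apply: eq_integral => y _; rewrite sumEFin (bigD1 (b y))//= big1.
    by rewrite indicE mem_set//= mulr1 addr0.
  move=> j jb; rewrite indicE memNset ?mulr0//= => bj.
  by rewrite bj eqxx in jb.
- by move=> j; apply/measurable_EFinP; exact: measurable_funM.
- by move=> j y _; rewrite lee_fin mulr_ge0.
Qed.

(** Averaging is an L^1 contraction preserving functions of [x] and the class of [y]: for fixed [x],
    [average_block] is applied on each class with the constant [s x j], and Tonelli's theorem
    integrates over [x]. *)
Lemma le_L1dist_average (J : finType) (b : Y -> J) (W : X * Y -> R) (s : X -> J -> R) :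
  finpart b -> measurable_fun setT W -> (forall z, 0 <= W z)%R ->
  (forall j, measurable_fun setT (s^~ j)) ->
  L1dist (P \x Q) (average b W) (fun z => s z.1 (b z.2)) <=
  L1dist (P \x Q) W (fun z => s z.1 (b z.2)).
Proof.
move=> mb mW W0 ms.
have mb2 : finpart (fun z : X * Y => b z.2).
  by have := finpart_comp (@measurable_snd _ _ X Y) mb.
have msb : measurable_fun setT (fun z : X * Y => s z.1 (b z.2)).
  apply: (@measurable_fun_finpart _ _ _ _ _ (fun j (z : X * Y) => s z.1 j) mb2) => j.
  exact: (measurableT_comp (ms j) measurable_fst).
have mA := measurable_average mb mW W0.
have mL1 := measurable_L1 mA msb; have mL2 := measurable_L1 mW msb.
rewrite /L1dist fubini_tonelli1// fubini_tonelli1//.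
apply: ge0_le_integral => //.
- by move=> x _; apply: integral_ge0 => y _; rewrite lee_fin.
- by apply: measurable_fun_fubini_tonelli_F.
- by apply: measurable_fun_fubini_tonelli_F.
move=> x _; rewrite /fubini_F/=.
have mWx : measurable_fun setT (fun y => W (x, y)).
  exact: (measurableT_comp mW (pair1_measurable x)).
rewrite (@integral_finpart _ _ (fun j _ =>
  `|slice W (b @^-1` [set j]) x / fine (Q (b @^-1` [set j])) - s x j|%R))//.
rewrite (@integral_finpart _ _ (fun j y => `|W (x, y) - s x j|%R))//; last first.
  by move=> j; apply: measurableT_comp => //; exact: measurable_funB.
apply: lee_sum => j _; apply: le_trans (average_block (s x j) mWx (mb j)).
under eq_integral do rewrite EFinM.
have m1 : measurable_fun setT (\1_(b @^-1` [set j]) : Y -> R).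
  by apply: measurable_indic; exact: mb.
rewrite ge0_integralZl_EFin//; last exact/measurable_EFinP.
by rewrite integral_indic ?setIT//; exact: mb.
Qed.

End averaging.

(** * Vanishing along a filter, and limits along ultrafilters *)

Section vanishing.
Context {R : realType} (S : Type) (F : set_system S) {FF : Filter F}.
Local Open Scope ereal_scope.
Implicit Types h k : S -> \bar R.

(** Convergence to 0 along [F], for nonnegative functions: only the upper bound is stated. *)
Definition vanishing h := forall e : R, (0 < e)%R -> F [set s | h s < e%:E].

(* The error [e] absorbs the parts of an estimate that are small for a reason
   independent of the filter. *)
Lemma vanishing_approx h :
  (forall e : R, (0 < e)%R ->
    exists2 k, vanishing k & F [set s | h s <= k s + e%:E]) -> vanishing h.
Proof.
move=> H e e0; have e2 : (0 < e / 2)%R by rewrite divr_gt0.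
have [k vk Fhk] := H _ e2.
apply: filterS2 Fhk (vk _ e2) => s /= hk ke.
apply: le_lt_trans hk _; rewrite [in ltRHS](splitr e) EFinD.
by rewrite lteD2rE.
Qed.

Lemma vanishing_le h k : F [set s | h s <= k s] -> vanishing k -> vanishing h.
Proof.
by move=> Fhk vk e e0; apply: filterS2 Fhk (vk _ e0) => s /= /le_lt_trans; apply.
Qed.

Lemma vanishingD h k : vanishing h -> vanishing k -> vanishing (fun s => h s + k s).
Proof.
move=> vh vk e e0; have e2 : (0 < e / 2)%R by rewrite divr_gt0.
apply: filterS2 (vh _ e2) (vk _ e2) => s /= he ke.
by rewrite [in ltRHS](splitr e) EFinD lteD.
Qed.

Lemma vanishing0 : vanishing (fun=> 0).
Proof. by move=> e e0; apply: filterE => s /=; rewrite lte_fin. Qed.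

Lemma vanishing_sum (I : finType) (h : I -> S -> \bar R) :
  (forall i, vanishing (h i)) -> vanishing (fun s => \sum_(i : I) h i s).
Proof.
move=> vh; elim: (index_enum I) => [|i r IH].
  by apply: vanishing_le vanishing0; apply: filterE => s /=; rewrite big_nil.
apply: vanishing_le (vanishingD (vh i) IH).
by apply: filterE => s /=; rewrite big_cons.
Qed.

Lemma vanishingZ (r : R) h : (0 <= r)%R -> (forall s, 0 <= h s) -> vanishing h ->
  vanishing (fun s => r%:E * h s).
Proof.
move=> r0 h0 vh e e0.
have r1 : (0 < r + 1)%R by rewrite ltr_wpDl.
have er : (0 < e / (r + 1))%R by rewrite divr_gt0.
apply: filterS (vh _ er) => s /= hs.
apply: (@le_lt_trans _ _ ((r + 1)%:E * h s)).
  by rewrite lee_wpmul2r// lee_fin lerDl.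
have -> : e%:E = (r + 1)%:E * (e / (r + 1))%:E :> \bar R.
  by rewrite -EFinM mulrC divfK// gt_eqF.
by rewrite lte_pmul2l.
Qed.

End vanishing.

(** The limit is the supremum of the [r] that are lower bounds of [h] along [F]. The upper estimate
    is where the ultrafilter property enters. *)
Lemma ultra_limit01 {R : realType} (S : Type) (F : set_system S)
    (h : S -> R) : UltraFilter F -> (forall s, 0 <= h s <= 1) ->
  exists l, vanishing F (fun s => `|h s - l|%:E).
Proof.
move=> UF h01; pose E := [set r | F [set s | r <= h s]].
have E0 : E 0 by apply: filterE => s /=; have /andP[] := h01 s.
have ubE : ubound E 1.
  move=> r /filter_ex[s /= rs]; apply: le_trans rs _.
  by have /andP[] := h01 s.
have supE : has_sup E by split; [exists 0|exists 1].
exists (sup E) => e e0.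
have [r Er ler] := sup_adherent e0 supE.
have F1 : F [set s | h s < sup E + e / 2].
  (* In the first case [sup E + e / 2] would itself belong to [E]. *)
  have [Fl|] := @in_ultra_setVsetC _ F [set s | sup E + e / 2 <= h s] UF.
    have : sup E + e / 2 <= sup E by apply: ub_le_sup => //; exists 1.
    by rewrite gerDl leNgt divr_gt0.
  by apply: filterS => s /=/negP; rewrite -ltNge.
apply: filterS2 Er F1 => s /= rs hs.
rewrite lte_fin ltr_norml; lra.
Qed.

(** * The disjoint union glued along a filter of couplings *)

Lemma pushforward_probability {R : realType} d d' (T : measurableType d)
    (T' : measurableType d') (P : probability T R) (phi : T -> T') :
  measurable_fun setT phi -> exists Q : probability T' R, measure_preserving P Q phi.
Proof.
move=> mphi.
pose f : {mfun T >-> T'} := HB.pack phi (isMeasurableFun.Build _ _ _ _ _ mphi).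
by exists (distribution P f); split.
Qed.

(** A separate name for the disjoint union, on which structures are declared; the base point is that
    of [T]. *)
Definition glued (T T' : Type) := (T + T')%type.

HB.instance Definition _ d d' (T : measurableType d) (T' : measurableType d') :=
  Choice.on (glued T T').
HB.instance Definition _ d d' (T : measurableType d) (T' : measurableType d') :=
  isPointed.Build (glued T T') (inl point).

(** A boolean [h] serves for sets, a finite [I] for partitions. *)
Definition mismatch {T T' : Type} {I : eqType} (h : glued T T' -> I) : set (T * T') :=
  [set z | h (inl z.1) != h (inr z.2)].

Section gluing.
Context {R : realType} d d' (T : measurableType d) (T' : measurableType d').
Variables (P : probability T R) (P' : probability T' R).
Variable F : set_system (probability (T * T')%type R).
Hypothesis FF : ProperFilter F.
Hypothesis Fcoupling : F [set nu | coupling P P' nu].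
Local Open Scope ereal_scope.

(* Under the limit of the couplings along [F], sets in [glue_sets] have the same
   trace on both components. *)
Definition glue_sets : set (set (glued T T')) :=
  [set D | [/\ measurable (inl @^-1` D : set T), measurable (inr @^-1` D : set T') &
    vanishing F (fun nu : probability (T * T')%type R =>
      nu (mismatch (fun s => s \in D)))]].

Lemma measurable_mismatch (I : finType) (h : glued T T' -> I) :
  finpart (fun x : T => h (inl x)) -> finpart (fun x : T' => h (inr x)) ->
  measurable (mismatch h).
Proof.
move=> h1 h2.
have h1' : finpart (fun z : T * T' => h (inl z.1)).
  by have := finpart_comp (@measurable_fst _ _ T T') h1.
have h2' : finpart (fun z : T * T' => h (inr z.2)).
  by have := finpart_comp (@measurable_snd _ _ T T') h2.
exact: (finpart_preimage [set i : I * I | i.1 != i.2] (finpart_pair h1' h2')).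
Qed.

Lemma measurable_mismatch_mem (D : set (glued T T')) :
  measurable (inl @^-1` D : set T) -> measurable (inr @^-1` D : set T') ->
  measurable (mismatch (fun s => s \in D)).
Proof.
move=> m1 m2; apply: (@measurable_mismatch bool).
  exact: (finpart_indic m1).
exact: (finpart_indic m2).
Qed.

(** A complement has the same mismatch. For a countable union, a mismatch outside those of the first
    [n] sets puts one coordinate in the tail of its traces, and the mass of a tail is the same under
    every coupling. *)
Lemma glue_sets_sigma_algebra : sigma_algebra setT glue_sets.
Proof.
split.
- split; [by rewrite preimage_set0|by rewrite preimage_set0|].
  apply: (@vanishing_le _ _ _ _ _ (fun=> 0)); last exact: vanishing0.
  apply: filterE => nu /=; rewrite (_ : mismatch _ = set0) ?measure0//.
  by apply/seteqP; split => // z /=; rewrite /mismatch/= !in_set0.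
- move=> D [m1 m2 vD]; rewrite setTD; split.
  + by rewrite -[X in measurable X]/(~` (inl @^-1` D)); exact: measurableC.
  + by rewrite -[X in measurable X]/(~` (inr @^-1` D)); exact: measurableC.
  + rewrite (_ : mismatch _ = mismatch (fun s => s \in D))//.
    by apply/seteqP; split => z; rewrite /mismatch/= !in_setC; do 2 case: (_ \in D).
- move=> D mD.
  have m1 k : measurable (inl @^-1` (D k) : set T) by case: (mD k).
  have m2 k : measurable (inr @^-1` (D k) : set T') by case: (mD k).
  have mU1 : measurable (inl @^-1` (\bigcup_k D k) : set T).
    by rewrite preimage_bigcup; exact: bigcupT_measurable.
  have mU2 : measurable (inr @^-1` (\bigcup_k D k) : set T').
    by rewrite preimage_bigcup; exact: bigcupT_measurable.
  split => //; apply: vanishing_approx => e e0.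
  have e2 : (0 < e / 2)%R by rewrite divr_gt0.
  have [n1 tail1] := bigcup_tail_small P m1 e2.
  have [n2 tail2] := bigcup_tail_small P' m2 e2.
  set A1 := _ `\` _ in tail1; set A2 := _ `\` _ in tail2.
  have mA1 : measurable A1.
    by apply: measurableD; [exact: bigcupT_measurable|exact: bigsetU_measurable].
  have mA2 : measurable A2.
    by apply: measurableD; [exact: bigcupT_measurable|exact: bigsetU_measurable].
  pose M k : set (T * T') := mismatch (fun s => s \in D k).
  have mM k : measurable (M k) by exact: measurable_mismatch_mem.
  have mB1 : measurable (fst @^-1` A1 : set (T * T')).
    by rewrite -[X in measurable X]setTI; exact: measurable_fst.
  have mB2 : measurable (snd @^-1` A2 : set (T * T')).
    by rewrite -[X in measurable X]setTI; exact: measurable_snd.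
  pose n := maxn n1 n2.
  exists (fun nu => \sum_(k < n) nu (M k)).
    by apply: vanishing_sum => k; case: (mD k).
  apply: filterS Fcoupling => nu cnu /=.
  have [_ nu1] := coupling_fst cnu; have [_ nu2] := coupling_snd cnu.
  apply: (@le_trans _ _ (nu (\big[setU/set0]_(k < n) M k `|` (fst @^-1` A1 `|` snd @^-1` A2)))).
    rewrite le_measure ?inE//.
    + exact: measurable_mismatch_mem.
    + by apply: measurableU; [exact: bigsetU_measurable|exact: measurableU].
    move=> z mz; have [Mz|nM] := pselect ((\big[setU/set0]_(k < n) M k) z).
      by left.
    have agree k : (k < n)%N -> (inl z.1 \in D k) = (inr z.2 \in D k).
      move=> kn; apply/eqP; apply: contra_notT nM => Mk.
      by rewrite -bigcup_mkord; exists k.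
    right; move: mz; rewrite /mismatch/=.
    (* If only the first point is in the union, agreement on the first [n] sets excludes it from all
       of them, so it is in the tail [A1]; the other case is symmetric. *)
    have [[k _ Dk]|nD] := pselect ((\bigcup_k D k) (inl z.1)).
      rewrite (mem_set (_ : (\bigcup_k D k) (inl z.1))); last by exists k.
      rewrite eq_sym eqb_id => /negP; rewrite inE => nD2; left; split.
        by exists k.
      rewrite -(bigcup_mkord n1 (fun k => inl @^-1` (D k))) => -[j jn1 /= Dj]; apply: nD2; exists j => //.
      by apply: set_mem; rewrite -agree ?mem_set// (leq_trans jn1)// leq_maxl.
    rewrite (memNset nD) eq_sym eqbF_neg negbK inE => -[k _ Dk]; right; split.
      by exists k.
    rewrite -(bigcup_mkord n2 (fun k => inr @^-1` (D k))) => -[j jn2 /= Dj]; apply: nD; exists j => //.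
    by apply: set_mem; rewrite agree ?mem_set// (leq_trans jn2)// leq_maxr.
  apply: le_trans (measureU2 _ _ _) _.
  + exact: bigsetU_measurable.
  + exact: measurableU.
  apply: leeD; first by apply: Boole_inequality => k _.
  apply: le_trans (measureU2 _ mB1 mB2) _.
  apply: (@le_trans _ _ (P A1 + P' A2)); first by rewrite -nu1// -nu2.
  rewrite [in leRHS](splitr e) EFinD.
  by apply: leeD; exact: ltW.
Qed.

(** Generation adds no set, [glue_sets] being a sigma-algebra already. *)
Definition glueT := g_sigma_algebraType glue_sets.

Lemma measurable_glueE : (measurable : set (set glueT)) = glue_sets.
Proof. exact: measurable_g_measurableTypeE glue_sets_sigma_algebra. Qed.

Lemma measurable_inl_glue : measurable_fun setT (inl : T -> glueT).
Proof. by move=> _ D; rewrite measurable_glueE setTI => -[]. Qed.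

Lemma measurable_inr_glue : measurable_fun setT (inr : T' -> glueT).
Proof. by move=> _ D; rewrite measurable_glueE setTI => -[]. Qed.

(** The push-forward of [P] serves. A coupling with mismatch of [D] below [e] shows that the two
    traces of [D] have masses within [e] of each other. *)
Lemma glue_probability : exists PG : probability glueT R,
  measure_preserving P PG inl /\ measure_preserving P' PG inr.
Proof.
have [PG [m1 P1]] := pushforward_probability P measurable_inl_glue.
exists PG; split => //; split; first exact: measurable_inr_glue.
move=> D mD; rewrite -P1//; move: mD; rewrite measurable_glueE => -[mD1 mD2 vD].
have mM := measurable_mismatch_mem mD1 mD2.
have mB1 : measurable (fst @^-1` (inl @^-1` D) : set (T * T')).
  by rewrite -[X in measurable X]setTI; exact: measurable_fst.
have mB2 : measurable (snd @^-1` (inr @^-1` D) : set (T * T')).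
  by rewrite -[X in measurable X]setTI; exact: measurable_snd.
have Pfin : P (inl @^-1` D) \is a fin_num by rewrite fin_num_measure.
have P'fin : P' (inr @^-1` D) \is a fin_num by rewrite fin_num_measure.
apply/eqP; rewrite eq_le; apply/andP; split; apply/lee_addgt0Pr => e e0.
- have [nu [/= cnu nue]] := filter_ex (filterI Fcoupling (vD _ e0)).
  have [_ nu1] := coupling_fst cnu; have [_ nu2] := coupling_snd cnu.
  rewrite -nu1// -nu2//; apply: le_trans (leeD (lexx _) (ltW nue)).
  apply: le_trans (measureU2 _ mB1 mM); rewrite le_measure ?inE//.
    exact: measurableU.
  move=> z /= Dz; have [|] := pselect (D (inl z.1)); first by left.
  by move=> nD; right; rewrite /mismatch/= (memNset nD) (mem_set Dz).
- have [nu [/= cnu nue]] := filter_ex (filterI Fcoupling (vD _ e0)).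
  have [_ nu1] := coupling_fst cnu; have [_ nu2] := coupling_snd cnu.
  rewrite -nu1// -nu2//; apply: le_trans (leeD (lexx _) (ltW nue)).
  apply: le_trans (measureU2 _ mB2 mM); rewrite le_measure ?inE//.
    exact: measurableU.
  move=> z /= Dz; have [|] := pselect (D (inr z.2)); first by left.
  by move=> nD; right; rewrite /mismatch/= (memNset nD) (mem_set Dz).
Qed.

(** A pair separated by [b] is separated by the class of its first label, so the mismatch of [b] is
    at most the sum of those of its classes. *)
Lemma vanishing_mismatch (J : finType) (b : glueT -> J) :
  finpart b -> vanishing F (fun nu : probability (T * T')%type R => nu (mismatch b)).
Proof.
move=> mb; pose M j : set (T * T') := mismatch (fun s : glued T T' => s \in b @^-1` [set j]).
have gb j : glue_sets (b @^-1` [set j]) by rewrite -measurable_glueE; exact: mb.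
have mM j : measurable (M j) by have [m1 m2 _] := gb j; exact: measurable_mismatch_mem.
apply: (@vanishing_le _ _ _ _ _
  (fun nu : probability (T * T')%type R => \sum_(j : J) nu (M j))); last first.
  by apply: vanishing_sum => j; have [] := gb j.
apply: filterE => nu /=.
have mbb : measurable (mismatch b).
  apply: measurable_mismatch.
    exact: (finpart_comp measurable_inl_glue mb).
  exact: (finpart_comp measurable_inr_glue mb).
apply: (@le_trans _ _ (\int[nu]_z (\1_(mismatch b) z)%:E)).
  by rewrite integral_indic// setIT.
apply: (@le_trans _ _ (\int[nu]_z (\sum_(j : J) (\1_(M j) z)%:E))); last first.
  rewrite ge0_integral_sum//; last first.
    by move=> j; apply/measurable_EFinP; exact: measurable_indic.
  by apply: lee_sum => j _; rewrite integral_indic// setIT.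
apply: ge0_le_integral => //.
- by apply/measurable_EFinP; exact: measurable_indic.
- by apply: emeasurable_sum => j; apply/measurable_EFinP; exact: measurable_indic.
move=> z _; rewrite sumEFin lee_fin [leLHS]indicE.
have [/set_mem mz|_] := boolP (z \in mismatch b); last exact: sumr_ge0.
rewrite (bigD1 (b (inl z.1)))//= indicE mem_set ?lerDl ?sumr_ge0//.
rewrite /M /mismatch/= mem_set//= memNset//=.
by move: mz; rewrite /mismatch/= => /eqP mz /esym.
Qed.

Definition glue (A : Type) (f : T -> A) (f' : T' -> A) (s : glueT) : A :=
  match s with inl x => f x | inr x => f' x end.

(** By [measurable_glue], matched measurable functions are the two restrictions of one measurable
    function on [glueT]. *)
Definition matched (f : T -> R) (f' : T' -> R) :=
  vanishing F (fun nu : probability (T * T')%type R =>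
    L1dist nu (f \o fst) (f' \o snd)).

(** The superlevel sets of [c + k.+1%:R^-1] increase to that of [c], and the layer lies in a
    remainder. All [n] from [n0] on are allowed so that two functions can share one width. *)
Lemma layer_small d0 (X : measurableType d0) (Q : probability X R) (f : X -> R) (c e : R) :
  measurable_fun setT f -> (0 < e)%R ->
  exists n0, forall n, (n0 <= n)%N ->
    Q [set x | (c < f x <= c + n.+1%:R^-1)%R] < e%:E.
Proof.
move=> mf e0; pose A k := [set x | (c + k.+1%:R^-1 < f x)%R].
have mA k : measurable (A k).
  rewrite -[X in measurable X]setTI.
  rewrite (_ : A k = f @^-1` [set` `]c + k.+1%:R^-1, +oo[%R]); first exact: mf.
  by apply/seteqP; split => x; rewrite /A /= in_itv/= andbT.
have [n0 tail] := bigcup_tail_small Q mA e0; exists n0 => n n0n.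
apply: le_lt_trans tail; rewrite le_measure ?inE//.
- rewrite -[X in measurable X]setTI.
  rewrite (_ : [set x | _] = f @^-1` [set` `]c, c + n.+1%:R^-1]%R]); first exact: mf.
  by apply/seteqP; split => x; rewrite /= in_itv.
- by apply: measurableD; [exact: bigcupT_measurable|exact: bigsetU_measurable].
move=> x /= /andP[cf fc]; split.
  have : (0 < f x - c)%R by rewrite subr_gt0.
  move=> /ltr_add_invr[k]; rewrite add0r => hk.
  by exists k => //; rewrite /A/= -ltrBrDl.
rewrite -bigcup_mkord => -[k /= kn0]; rewrite /A/=; apply/negP; rewrite -leNgt.
apply: le_trans fc _; rewrite lerD2l lef_pV2 ?posrE//.
by rewrite ler_nat ltnS (leq_trans (ltnW kn0)).
Qed.

Lemma L1dist_markov d0 (X : measurableType d0) (Q : probability X R) (f g : X -> R) (t : R) :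
  measurable_fun setT f -> measurable_fun setT g -> (0 < t)%R ->
  Q [set x | (t <= `|f x - g x|)%R] <= (t^-1)%:E * L1dist Q f g.
Proof.
move=> mf mg t0; set A := [set x | _].
have mfg : measurable_fun setT (fun x => `|f x - g x|%R).
  by apply: measurableT_comp => //; exact: measurable_funB.
have mA : measurable A.
  rewrite -[X in measurable X]setTI.
  rewrite (_ : A = (fun x => `|f x - g x|%R) @^-1` [set` `[t, +oo[%R]); first exact: mfg.
  by apply/seteqP; split => x; rewrite /A /= in_itv/= andbT.
rewrite /L1dist -ge0_integralZl_EFin ?invr_ge0 ?(ltW t0)//; last exact: measurable_L1.
apply: (@le_trans _ _ (\int[Q]_x (\1_A x)%:E)); first by rewrite integral_indic// setIT.
apply: ge0_le_integral => //.
- by apply/measurable_EFinP; exact: measurable_indic.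
- by apply: measurable_funeM; exact: measurable_L1.
move=> x _; rewrite -EFinM lee_fin indicE.
have [/set_mem Ax|_] := boolP (x \in A); last by rewrite mulr_ge0// invr_ge0 ltW.
by rewrite ler_pdivlMl// mulr1.
Qed.

(** For the ray above [c], a mismatch means that [f] and [f'] differ by at least [t], or that one of
    them lies in the layer between [c] and [c + t]. Markov's inequality bounds the former; the
    layers have masses fixed by the marginals. *)
Lemma measurable_glue (f : T -> R) (f' : T' -> R) :
  measurable_fun setT f -> measurable_fun setT f' -> matched f f' ->
  measurable_fun setT (glue f f').
Proof.
move=> mf mf' ff'.
apply: (measurability _ (RGenOInfty.measurableE R)) => _ [_ [c ->] <-].
rewrite setTI measurable_glueE.
have E1 : inl @^-1` (glue f f' @^-1` `]c, +oo[%classic) = f @^-1` `]c, +oo[%classic by [].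
have E2 : inr @^-1` (glue f f' @^-1` `]c, +oo[%classic) = f' @^-1` `]c, +oo[%classic by [].
have m1 : measurable (f @^-1` `]c, +oo[%classic).
  by rewrite -[X in measurable X]setTI; exact: mf.
have m2 : measurable (f' @^-1` `]c, +oo[%classic).
  by rewrite -[X in measurable X]setTI; exact: mf'.
split; [by rewrite E1|by rewrite E2|].
apply: vanishing_approx => e e0.
have e2 : (0 < e / 2)%R by rewrite divr_gt0.
have [n1 L1] := layer_small P c mf e2.
have [n2 L2] := layer_small P' c mf' e2.
pose n := maxn n1 n2; pose t : R := (n.+1%:R^-1)%R.
have t0 : (0 < t)%R by rewrite invr_gt0.
(* The width [t] is already fixed, so this bound vanishes along [F]. *)
exists (fun nu => (t^-1)%:E * L1dist nu (f \o fst) (f' \o snd)).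
  by apply: vanishingZ => //; [rewrite invr_ge0 ltW|move=> nu; exact: L1dist_ge0].
apply: filterS Fcoupling => nu cnu /=.
have [_ nu1] := coupling_fst cnu; have [_ nu2] := coupling_snd cnu.
have mf1 : measurable_fun setT (f \o fst : T * T' -> R) by exact: measurableT_comp.
have mf2 : measurable_fun setT (f' \o snd : T * T' -> R) by exact: measurableT_comp.
pose A1 := [set x | (c < f x <= c + t)%R]; pose A2 := [set x | (c < f' x <= c + t)%R].
have mA1 : measurable A1.
  rewrite -[X in measurable X]setTI.
  rewrite (_ : A1 = f @^-1` [set` `]c, c + t]%R]); first exact: mf.
  by apply/seteqP; split => x; rewrite /A1 /= in_itv.
have mA2 : measurable A2.
  rewrite -[X in measurable X]setTI.
  rewrite (_ : A2 = f' @^-1` [set` `]c, c + t]%R]); first exact: mf'.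
  by apply/seteqP; split => x; rewrite /A2 /= in_itv.
pose A3 := [set z : T * T' | (t <= `|f z.1 - f' z.2|)%R].
have mA3 : measurable A3.
  have mfg : measurable_fun setT (fun z : T * T' => `|f z.1 - f' z.2|%R).
    by apply: measurableT_comp => //; exact: measurable_funB.
  rewrite -[X in measurable X]setTI.
  rewrite (_ : A3 = (fun z => `|f z.1 - f' z.2|%R) @^-1` [set` `[t, +oo[%R]); first exact: mfg.
  by apply/seteqP; split => x; rewrite /A3 /= in_itv/= andbT.
have mB1 : measurable (fst @^-1` A1 : set (T * T')).
  by rewrite -[X in measurable X]setTI; exact: measurable_fst.
have mB2 : measurable (snd @^-1` A2 : set (T * T')).
  by rewrite -[X in measurable X]setTI; exact: measurable_snd.
apply: (@le_trans _ _ (nu (A3 `|` (fst @^-1` A1 `|` snd @^-1` A2)))).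
  rewrite le_measure ?inE//.
  - exact: (measurable_mismatch_mem m1 m2).
  - by apply: measurableU => //; exact: measurableU.
  move=> z; rewrite /mismatch /A1 /A2 /A3/= => mz.
  have {}mz : (c < f z.1)%R != (c < f' z.2)%R.
    apply: contra mz => /eqP mz.
    rewrite (_ : (inl z.1 \in _) = (c < f z.1)%R); last first.
      by apply/idP/idP => [/set_mem|h]; [|apply: mem_set]; rewrite /= in_itv/= andbT.
    rewrite (_ : (inr z.2 \in _) = (c < f' z.2)%R); last first.
      by apply/idP/idP => [/set_mem|h]; [|apply: mem_set]; rewrite /= in_itv/= andbT.
    by rewrite mz.
  have [?|dt] := lerP t (`|f z.1 - f' z.2|)%R; [by left|right].
  move: dt mz; rewrite ltr_norml => /andP[d1 d2].
  case: (ltP c (f z.1)) => cf; case: (ltP c (f' z.2)) => // cf' _.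
    left; lra.
  right; lra.
apply: le_trans (measureU2 _ mA3 (measurableU _ _ mB1 mB2)) _.
apply: leeD; first exact: L1dist_markov.
apply: le_trans (measureU2 _ mB1 mB2) _.
apply: (@le_trans _ _ (P A1 + P' A2)); first by rewrite -nu1// -nu2.
rewrite [in leRHS](splitr e) EFinD.
by apply: leeD; apply: ltW; [apply: L1|apply: L2]; rewrite ?leq_maxl ?leq_maxr.
Qed.

End gluing.

(** * Real-valued integrals over sets and of step functions *)

Section fine_integrals.
Context {R : realType} d (Z : measurableType d) (Q : probability Z R).
Local Open Scope ereal_scope.

Lemma integrableM_indic (g : Z -> R) (A : set Z) : measurable A ->
  Q.-integrable setT (EFin \o g) ->
  Q.-integrable setT (fun z => (g z * \1_A z)%:E).
Proof.
move=> mA ig; have mg : measurable_fun setT g by apply/measurable_EFinP; exact: measurable_int ig.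
apply: le_integrable ig => //.
  by apply/measurable_EFinP; apply: measurable_funM => //; exact: measurable_indic.
move=> z _ /=; rewrite lee_fin normrM ler_piMr// indicE.
by case: (_ \in _); rewrite ?normr1 ?normr0.
Qed.

Lemma L1dist_integrable (g k : Z -> R) : measurable_fun setT g ->
  Q.-integrable setT (EFin \o k) -> L1dist Q g k < +oo ->
  Q.-integrable setT (EFin \o g).
Proof.
move=> mg ik gk.
have mk : measurable_fun setT k by apply/measurable_EFinP; exact: measurable_int ik.
have igk : Q.-integrable setT (fun z => (g z - k z)%:E).
  apply/integrableP; split => //.
  by apply/measurable_EFinP; exact: measurable_funB.
apply: eq_integrable (integrableD measurableT igk ik) => //.
by move=> z _ /=; rewrite -EFinD subrK.
Qed.

Lemma dist_fine_integral_le (g k : Z -> R) (A : set Z) : measurable A ->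
  measurable_fun setT g -> Q.-integrable setT (EFin \o k) ->
  `|fine (\int[Q]_z (g z * \1_A z)%:E) - fine (\int[Q]_z (k z * \1_A z)%:E)|%:E
  <= L1dist Q g k.
Proof.
move=> mA mg ik.
have [->|gkoo] := eqVneq (L1dist Q g k) +oo; first by rewrite leey.
have mk : measurable_fun setT k by apply/measurable_EFinP; exact: measurable_int ik.
have ig : Q.-integrable setT (EFin \o g).
  by apply: L1dist_integrable ik _ => //; rewrite ltey.
have igA := integrableM_indic mA ig; have ikA := integrableM_indic mA ik.
have gf := integrable_fin_num measurableT igA.
have kf := integrable_fin_num measurableT ikA.
rewrite -abse_EFin EFinB !fineK// -integralB_EFin//.
have mgA : measurable_fun setT (fun z => (g z * \1_A z - k z * \1_A z)%R).
  by apply: measurable_funB; apply: measurable_funM => //; exact: measurable_indic.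
apply: le_trans (le_abse_integral _ _ _) _ => //.
  by under eq_fun do rewrite -EFinB; exact/measurable_EFinP.
under eq_integral do rewrite -EFinB abse_EFin.
rewrite /L1dist; apply: ge0_le_integral => //.
- by apply/measurable_EFinP; exact: measurableT_comp.
- exact: measurable_L1.
move=> z _; rewrite lee_fin -mulrBl normrM ler_piMr// indicE.
by case: (_ \in _); rewrite ?normr1 ?normr0.
Qed.

Lemma finpart_integrable (J : finType) (b : Z -> J) (c : J -> R) :
  finpart b -> Q.-integrable setT (fun z => (c (b z))%:E).
Proof.
move=> mb; have mc : measurable_fun setT (fun z => c (b z)).
  exact: (@measurable_fun_finpart _ _ _ _ b (fun j _ => c j)).
apply: measurable_bounded_integrable => //.
  by rewrite (le_lt_trans (probability_le1 _ _)) ?ltry.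
exists (\sum_j `|c j|)%R; split; first exact: num_real.
move=> M ltM z _ /=; apply: le_trans (ltW ltM).
by rewrite (bigD1 (b z))//= lerDl sumr_ge0.
Qed.

Lemma fine_integral_finpart (J : finType) (b : Z -> J) (c : J -> R) (A : set Z) :
  finpart b -> measurable A ->
  fine (\int[Q]_z (c (b z) * \1_A z)%:E) =
    (\sum_j c j * fine (Q (A `&` b @^-1` [set j])))%R.
Proof.
move=> mb mA.
have mAb j : measurable (A `&` b @^-1` [set j]) by apply: measurableI => //; exact: mb.
have i1 j : Q.-integrable setT (fun z => (\1_(A `&` b @^-1` [set j]) z)%:E).
  by apply: integrable_indic => //; rewrite (le_lt_trans (probability_le1 _ _)) ?ltry.
have -> : \int[Q]_z (c (b z) * \1_A z)%:E =
    \int[Q]_z (\sum_j (c j)%:E * (\1_(A `&` b @^-1` [set j]) z)%:E).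
  apply: eq_integral => z _; rewrite (bigD1 (b z))//= big1.
    rewrite adde0 -EFinM !indicE in_setI (_ : (z \in b @^-1` _) = true) ?andbT//.
    exact: mem_set.
  move=> j jb; rewrite indicE memNset ?mule0// => -[_ /= bj].
  by rewrite bj eqxx in jb.
rewrite integral_sum//; last by move=> j; exact: integrableZl.
rewrite (eq_bigr (fun j => (c j * fine (Q (A `&` b @^-1` [set j])))%:E)).
  by rewrite sumEFin.
move=> j _; rewrite integralZl// integral_indic// setIT EFinM fineK//.
by rewrite fin_num_measure.
Qed.

End fine_integrals.

(** * Slices of [W] have partners on the second space *)

Section partners.
Context {R : realType} d d' (T : measurableType d) (T' : measurableType d').
Variables (P : probability T R) (P' : probability T' R).
Variables (W : T -> T -> R) (W' : T' -> T' -> R).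
Variable F : set_system (probability (T * T')%type R).
Hypothesis UF : UltraFilter F.
Hypothesis Fcoupling : F [set nu | coupling P P' nu].
Hypothesis gW : graphon P W.
Hypothesis gW' : graphon P' W'.
Hypothesis FW : vanishing F (fun nu : probability (T * T')%type R =>
  L1dist (nu \x nu)%E (fun z => W z.1.1 z.2.1) (fun z => W' z.1.2 z.2.2)).
Local Open Scope ereal_scope.

Let Wp (z : T * T) := W z.1 z.2.
Let Wp' (z : T' * T') := W' z.1 z.2.

Lemma graphon_integrable d0 (X : measurableType d0) (Q : probability X R) (V : X -> X -> R) :
  graphon Q V -> (Q \x Q).-integrable setT (EFin \o (fun z : X * X => V z.1 z.2)).
Proof.
move=> [mV _ _ iV]; apply/integrableP; split; first exact/measurable_EFinP.
by [].
Qed.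

(** Under a coupling [nu], the slice at [x] integrates [W x] over the pairs with first coordinate in
    [A]. Replacing [W] by [W'] and then by a step function leaves a combination of the masses
    [nu (B j)]. Their limits along the ultrafilter make [f'] independent of [nu]. *)
Lemma slice_partner_approx (A : set T) (e : R) : measurable A -> (0 < e)%R ->
  exists2 f', measurable_fun setT f' &
    F [set nu | L1dist nu (slice P Wp A \o fst) (f' \o snd) < e%:E].
Proof.
move=> mA e0; have e2 : (0 < e / 2)%R by rewrite divr_gt0.
have [mW _ W0 iW] := gW; have [mW' _ W'0 iW'] := gW'.
have [I [J [a [b [c [ma mb abc]]]]]] := step_approxP (graphon_integrable gW') e2.
pose B j : set (T * T') := fst @^-1` A `&` (b \o snd) @^-1` [set j].
have mA1 : measurable (fst @^-1` A : set (T * T')).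
  by rewrite -[X in measurable X]setTI; exact: measurable_fst.
have mb2 : finpart (b \o snd : T * T' -> J) := finpart_comp (@measurable_snd _ _ T T') mb.
have ma2 : finpart (a \o snd : T * T' -> I) := finpart_comp (@measurable_snd _ _ T T') ma.
have mB j : measurable (B j) by apply: measurableI => //; exact: mb2.
have lim j : exists l, vanishing F (fun nu : probability (T * T')%type R =>
    `|fine (nu (B j)) - l|%:E).
  apply: ultra_limit01 => nu; rewrite fine_ge0//= -lee_fin fineK ?fin_num_measure//.
  exact: probability_le1.
pose beta j := sval (cid (lim j)).
have vbeta j : vanishing F (fun nu : probability (T * T')%type R =>
    `|fine (nu (B j)) - beta j|%:E) by rewrite /beta; case: cid.
have [C C0 cC] := fin_fun2_bound c.
pose f' x' : R := (\sum_j c (a x') j * beta j)%R.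
have mf' : measurable_fun setT f'.
  exact: (@measurable_fun_finpart _ _ _ _ a (fun i _ => (\sum_j c i j * beta j)%R)).
exists f' => //.
have mWp : measurable_fun setT Wp by exact: mW.
have mS := measurable_slice P mWp (fun z => W0 z.1 z.2) mA.
(* [k] collects the errors that vanish along [F]; the step approximation of [W'] takes the other
   half of [e]. *)
pose k (nu : probability (T * T')%type R) : \bar R :=
  L1dist (nu \x nu) (fun z => W z.1.1 z.2.1) (fun z => W' z.1.2 z.2.2) +
  \sum_j C%:E * `|fine (nu (B j)) - beta j|%:E.
have vk : vanishing F k.
  by apply: vanishingD => //; apply: vanishing_sum => j; apply: vanishingZ.
apply: filterS2 Fcoupling (vk _ e2) => nu /= cnu ke.
rewrite (splitr e) EFinD; apply: le_lt_trans (lteD ke abc); rewrite /k.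
have mp1 := measure_preserving_prod (coupling_fst cnu) (coupling_fst cnu).
have mp2 := measure_preserving_prod (coupling_snd cnu) (coupling_snd cnu).
have mstep : measurable_fun setT (fun z : T' * T' => c (a z.1) (b z.2)).
  exact: measurable_step c ma mb.
rewrite -(L1dist_mp mp2)//.
have m11 : measurable_fun setT (fun z : (T * T') * (T * T') => W z.1.1 z.2.1).
  exact: (measurableT_comp mW mp1.1).
have m22 : measurable_fun setT (fun z : (T * T') * (T * T') => W' z.1.2 z.2.2).
  exact: (measurableT_comp mW' mp2.1).
have mcc : measurable_fun setT (fun z : (T * T') * (T * T') => c (a z.1.2) (b z.2.2)).
  exact: (measurableT_comp mstep mp2.1).
have tri : L1dist (nu \x nu) (fun z => W z.1.1 z.2.1) (fun z => c (a z.1.2) (b z.2.2)) <=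
    L1dist (nu \x nu) (fun z => W z.1.1 z.2.1) (fun z => W' z.1.2 z.2.2) +
    L1dist (nu \x nu) (fun z => W' z.1.2 z.2.2) (fun z => c (a z.1.2) (b z.2.2)).
  exact: L1dist_triangle.
rewrite addeAC; apply: le_trans (leeD tri (lexx _)).
rewrite sumEFin; set E := (\sum_j _)%R.
have E0 : (0 <= E)%R by apply: sumr_ge0 => j _; rewrite mulr_ge0.
have mK := measurable_L1 m11 mcc.
(* The second pair is integrated out, leaving for each first pair the L^1 distance of two
   sections. *)
apply: (@le_trans _ _ (\int[nu]_z (L1dist nu (fun w => W z.1 w.1) (fun w => c (a z.2) (b w.2)) + E%:E))); last first.
  have mKF : measurable_fun setT (fun z : T * T' =>
      L1dist nu (fun w : T * T' => W z.1 w.1) (fun w => c (a z.2) (b w.2))).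
    by apply: (@measurable_fun_fubini_tonelli_F _ _ _ _ _ nu _ mK).
  have KF0 (z : T * T') : setT z ->
      0 <= L1dist nu (fun w : T * T' => W z.1 w.1) (fun w => c (a z.2) (b w.2)).
    by move=> _; exact: L1dist_ge0.
  rewrite ge0_integralD//.
  rewrite integral_cst_probability; apply: leeD => //.
  by rewrite /L1dist fubini_tonelli1.
apply: le_L1dist.
- exact: (measurableT_comp mS measurable_fst).
- exact: (measurableT_comp mf' measurable_snd).
- apply: emeasurable_funD => //.
  exact: (@measurable_fun_fubini_tonelli_F _ _ _ _ _ nu _ mK).
move=> z /=.
have mWx : measurable_fun setT (fun y => W z.1 y).
  exact: (measurableT_comp mW (pair1_measurable z.1)).
have mW1 : measurable_fun setT (fun w : T * T' => W z.1 w.1).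
  exact: (measurableT_comp mWx measurable_fst).
have -> : slice P Wp A z.1 = fine (\int[nu]_w (W z.1 w.1 * \1_(fst @^-1` A) w)%:E).
  rewrite /slice -(ge0_integral_mp (coupling_fst cnu))//.
    by apply/measurable_EFinP; apply: measurable_funM => //; exact: measurable_indic.
  by move=> y; rewrite lee_fin mulr_ge0// W0.
have ic := @finpart_integrable _ _ _ nu _ _ (c (a z.2)) mb2.
apply: (@le_trans _ _ (`|fine (\int[nu]_w (W z.1 w.1 * \1_(fst @^-1` A) w)%:E)
   - fine (\int[nu]_w (c (a z.2) (b w.2) * \1_(fst @^-1` A) w)%:E)|%:E
  + `|fine (\int[nu]_w (c (a z.2) (b w.2) * \1_(fst @^-1` A) w)%:E) - f' z.2|%:E)).
  by rewrite -EFinD lee_fin ler_distD.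
apply: leeD; first exact: dist_fine_integral_le.
rewrite (fine_integral_finpart nu (c (a z.2)) mb2 mA1) lee_fin /f' -sumrB.
apply: le_trans (ler_norm_sum _ _ _) _; apply: ler_sum => j _.
by rewrite -mulrBr normrM ler_wpM2r.
Qed.

(** Two approximate partners are both near the slice under a common coupling, hence near each other
    in L^1 of [P']; their limit is an exact partner. *)
Lemma slice_partner (A : set T) : measurable A ->
  exists2 f', measurable_fun setT f' & matched F (slice P Wp A) f'.
Proof.
move=> mA; have [mW _ W0 iW] := gW.
have mWp : measurable_fun setT Wp by exact: mW.
have mS := measurable_slice P mWp (fun z => W0 z.1 z.2) mA.
have mS1 : measurable_fun setT (slice P Wp A \o fst : T * T' -> R).
  exact: (measurableT_comp mS measurable_fst).
have m2 (g : T' -> R) : measurable_fun setT g -> measurable_fun setT (g \o snd : T * T' -> R).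
  by move=> mg; exact: (measurableT_comp mg measurable_snd).
have [||f' mf' Hf'] := @L1_complete _ _ _ P' (fun e f' => measurable_fun setT f' /\
    F [set nu | L1dist nu (slice P Wp A \o fst) (f' \o snd) < e%:E]).
- move=> e e0; have [f' mf' Ff'] := slice_partner_approx mA e0.
  by exists f'.
- move=> e e' f f' [mf Ff] [mf' Ff'].
  have [nu [/= cnu [h h']]] := filter_ex (filterI Fcoupling (filterI Ff Ff')).
  rewrite -(L1dist_mp (coupling_snd cnu))//.
  apply: le_trans (L1dist_triangle _ (m2 _ mf) mS1 (m2 _ mf')) _.
  by rewrite EFinD; apply: leeD; [rewrite L1distC|]; exact: ltW.
exists f' => // e e0; have e2 : (0 < e / 2)%R by rewrite divr_gt0.
have [f [e' [mf e'e [_ Ff] ff']]] := Hf' _ e2.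
apply: filterS2 Fcoupling Ff => nu /= cnu h.
apply: le_lt_trans (L1dist_triangle _ mS1 (m2 _ mf) (m2 _ mf')) _.
rewrite (splitr e) EFinD; apply: lteD.
  by apply: lt_trans h _; rewrite lte_fin.
by rewrite (L1dist_mp (coupling_snd cnu)).
Qed.

End partners.

(** * Exchange of variables, symmetrization, and transfer of step functions *)

Section swap_and_transfer.
Context {R : realType}.
Local Open Scope ereal_scope.

Lemma measure_preserving_swap d1 d2 (X : measurableType d1) (Y : measurableType d2)
  (P : probability X R) (Q : probability Y R) :
  measure_preserving (P \x Q) (Q \x P) (fun z : X * Y => (z.2, z.1)).
Proof.
have ms : measurable_fun setT (fun z : X * Y => (z.2, z.1)).
  by apply/measurable_fun_pairP; split; [exact: measurable_snd|exact: measurable_fst].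
split => // A mA; apply/esym.
have := @product_measure_unique _ _ _ _ _ Q P
  (pushforward (P \x Q) (fun z : X * Y => (z.2, z.1))).
apply => // B C mB mC.
rewrite -[LHS]/((P \x Q) ((fun z : X * Y => (z.2, z.1)) @^-1` (B `*` C))).
rewrite (_ : _ @^-1` _ = C `*` B); first by rewrite product_measure1E// muleC.
by apply/seteqP; split => z [].
Qed.

Lemma measure_preserving_fst d1 d2 (X : measurableType d1) (Y : measurableType d2)
  (P : probability X R) (Q : probability Y R) :
  measure_preserving (P \x Q) P (@fst X Y).
Proof.
split => // A mA; rewrite (_ : fst @^-1` A = A `*` setT).
  apply: etrans (product_measure1E _ _ mA measurableT) _.
  by rewrite [X in _ * X](_ : _ = 1) ?mule1//; exact: probability_setT.
by apply/seteqP; split => z //= [].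
Qed.

Lemma measure_preserving_snd d1 d2 (X : measurableType d1) (Y : measurableType d2)
  (P : probability X R) (Q : probability Y R) :
  measure_preserving (P \x Q) Q (@snd X Y).
Proof.
split => // A mA; rewrite (_ : snd @^-1` A = setT `*` A).
  apply: etrans (product_measure1E _ _ measurableT mA) _.
  by rewrite [X in X * _](_ : _ = 1) ?mul1e//; exact: probability_setT.
by apply/seteqP; split => z //= [].
Qed.

Lemma integrable_mp d1 d2 (X : measurableType d1) (Y : measurableType d2)
  (P : probability X R) (Q : probability Y R) phi (V : Y -> R) :
  measure_preserving P Q phi -> measurable_fun setT V ->
  P.-integrable setT (EFin \o (V \o phi)) -> Q.-integrable setT (EFin \o V).
Proof.
move=> Pphi mV /integrableP[_ iV]; apply/integrableP; split; first exact/measurable_EFinP.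
rewrite -(ge0_integral_mp Pphi)//.
by apply: measurableT_comp => //; exact/measurable_EFinP.
Qed.

(** The average of [W] is no farther from the step function than [W] is, so the triangle inequality
    at most doubles the error. *)
Lemma L1dist_average_lt d d' (X : measurableType d) (Y : measurableType d')
  (P : probability X R) (Q : probability Y R) (I J : finType)
  (a : X -> I) (b : Y -> J) (c : I -> J -> R) (W : X * Y -> R) (e : R) :
  finpart a -> finpart b -> measurable_fun setT W -> (forall z, 0 <= W z)%R ->
  L1dist (P \x Q) W (fun z => c (a z.1) (b z.2)) < e%:E ->
  L1dist (P \x Q) W (average Q b W) < (e + e)%:E.
Proof.
move=> ma mb mW W0 h; have mc := measurable_step c ma mb.
have mA := measurable_average Q mb mW W0.
apply: le_lt_trans (L1dist_triangle _ mW mc mA) _.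
rewrite EFinD; apply: lteD => //; rewrite L1distC; apply: le_lt_trans h.
apply: (@le_L1dist_average _ _ _ _ _ P Q J b W (fun x j => c (a x) j)) => // j.
exact: (@measurable_fun_finpart _ _ _ _ a (fun i _ => c i j)).
Qed.

(** An L^1 limit need not be symmetric or nonnegative everywhere, while this expression is. As [W]
    is both, the pointwise error is at most the sum of the errors of [V] at [z] and at its mirror
    image. *)
Lemma L1dist_symmetrize d (X : measurableType d) (Q : probability X R)
  (V W : X * X -> R) : measurable_fun setT V -> measurable_fun setT W ->
  (forall x y, W (x, y) = W (y, x)) -> (forall z, 0 <= W z)%R ->
  L1dist (Q \x Q) V W = 0 ->
  L1dist (Q \x Q) (fun z => `|V z + V (z.2, z.1)| / 2)%R W = 0.
Proof.
move=> mV mW Wsym W0 VW.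
have [msw Psw] := measure_preserving_swap Q Q.
have mVs : measurable_fun setT (V \o (fun z : X * X => (z.2, z.1))).
  exact: measurableT_comp.
have Ws : W \o (fun z : X * X => (z.2, z.1)) = W.
  by apply/funext => -[x y] /=; rewrite Wsym.
have VWs : L1dist (Q \x Q) (V \o (fun z : X * X => (z.2, z.1))) W = 0.
  by rewrite -[X in L1dist _ _ X]Ws (L1dist_mp (measure_preserving_swap Q Q)).
apply/eqP; rewrite eq_le L1dist_ge0 andbT.
have -> : 0 = L1dist (Q \x Q) V W + L1dist (Q \x Q) (V \o (fun z : X * X => (z.2, z.1))) W.
  by rewrite VW VWs adde0.
have m1 := measurable_L1 mV mW; have m2 := measurable_L1 mVs mW.
rewrite /L1dist -ge0_integralD//.
apply: le_L1dist => //.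
- apply: measurable_funM => //; apply: measurableT_comp => //.
  exact: measurable_funD.
- exact: emeasurable_funD.
move=> z; rewrite -EFinD lee_fin /=.
set v := V z; set v' := V _; have := W0 z; set w := W z => w0.
case: (ger0P (v + v')) => ?; case: (ger0P (v - w)) => ?;
  case: (ger0P (v' - w)) => ?; rewrite ler_norml; lra.
Qed.

(** Where the first pair agrees on [a] and the second on [b], the two readings of [c] coincide;
    elsewhere they differ by at most [2 * C]. *)
Lemma L1dist_step_le d d' (T : measurableType d) (T' : measurableType d')
  (nu : probability (T * T')%type R) (I J : finType)
  (a : glued T T' -> I) (b : glued T T' -> J) (c : I -> J -> R) (C : R) :
  (forall i j, `|c i j| <= C)%R ->
  finpart (fun x : T => a (inl x)) -> finpart (fun x : T' => a (inr x)) ->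
  finpart (fun x : T => b (inl x)) -> finpart (fun x : T' => b (inr x)) ->
  L1dist (nu \x nu) (fun z => c (a (inl z.1.1)) (b (inl z.2.1)))
    (fun z => c (a (inr z.1.2)) (b (inr z.2.2))) <=
  (2 * C)%:E * nu (mismatch a) + (2 * C)%:E * nu (mismatch b).
Proof.
move=> cC mal mar mbl mbr.
have C0 : (0 <= C)%R by exact: le_trans (cC (a (inl point)) (b (inl point))).
have mMa := measurable_mismatch mal mar; have mMb := measurable_mismatch mbl mbr.
have m1 : measurable_fun setT (fun z : (T * T') * (T * T') =>
    c (a (inl z.1.1)) (b (inl z.2.1))).
  by apply: (measurable_step c (a := fun x : T * T' => a (inl x.1))
    (b := fun x : T * T' => b (inl x.1)));
    [have := finpart_comp (@measurable_fst _ _ T T') mal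
    |have := finpart_comp (@measurable_fst _ _ T T') mbl].
have m2 : measurable_fun setT (fun z : (T * T') * (T * T') =>
    c (a (inr z.1.2)) (b (inr z.2.2))).
  by apply: (measurable_step c (a := fun x : T * T' => a (inr x.2))
    (b := fun x : T * T' => b (inr x.2)));
    [have := finpart_comp (@measurable_snd _ _ T T') mar
    |have := finpart_comp (@measurable_snd _ _ T T') mbr].
pose k (M : set (T * T')) (w : T * T') : \bar R := (2 * C * \1_M w)%:E.
have mk M : measurable M -> measurable_fun setT (k M).
  by move=> mM; apply/measurable_EFinP; apply: measurable_funM => //; exact: measurable_indic.
have k0 M w : 0 <= k M w by rewrite lee_fin !mulr_ge0.
have kE M : measurable M -> \int[nu]_w k M w = (2 * C)%:E * nu M.
  move=> mM; under eq_integral do rewrite /k EFinM.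
  rewrite ge0_integralZl_EFin ?mulr_ge0//; last first.
    by apply/measurable_EFinP; exact: measurable_indic.
  by rewrite integral_indic// setIT.
rewrite -!kE// -(ge0_integral_mp (measure_preserving_fst nu nu))//; last exact: mk.
rewrite -[X in _ + X](ge0_integral_mp (measure_preserving_snd nu nu))//; last exact: mk.
have mk1 : measurable_fun setT (fun z : (T * T') * (T * T') => k (mismatch a) z.1).
  exact: (measurableT_comp (mk _ mMa) measurable_fst).
have mk2 : measurable_fun setT (fun z : (T * T') * (T * T') => k (mismatch b) z.2).
  exact: (measurableT_comp (mk _ mMb) measurable_snd).
rewrite -ge0_integralD//; apply: le_L1dist => //; first exact: emeasurable_funD.
move=> [w w'] /=; rewrite /k -EFinD lee_fin.
have c2 i j i' j' : (`|c i j - c i' j'| <= 2 * C)%R.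
  by apply: le_trans (ler_normB _ _) _; have := cC i j; have := cC i' j'; lra.
have [aE|aN] := eqVneq (a (inl w.1)) (a (inr w.2)); last first.
  rewrite indicE mem_set// mulr1; apply: le_trans (c2 _ _ _ _) _.
  by rewrite lerDl !mulr_ge0.
have [bE|bN] := eqVneq (b (inl w'.1)) (b (inr w'.2)); last first.
  rewrite [X in (_ + _ * X)%R]indicE mem_set// mulr1; apply: le_trans (c2 _ _ _ _) _.
  by rewrite lerDr !mulr_ge0.
by rewrite aE bE subrr normr0 addr_ge0// !mulr_ge0.
Qed.

End swap_and_transfer.

(** * From L^1 distance vanishing along an ultrafilter to a common kernel *)

Section zero_distance_equiv.
Context {R : realType} d d' (T : measurableType d) (T' : measurableType d').
Variables (P : probability T R) (P' : probability T' R).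
Variables (W : T -> T -> R) (W' : T' -> T' -> R).
Variable F : set_system (probability (T * T')%type R).
Hypothesis UF : UltraFilter F.
Hypothesis Fcoupling : F [set nu | coupling P P' nu].
Hypothesis gW : graphon P W.
Hypothesis gW' : graphon P' W'.
Hypothesis FW : vanishing F (fun nu : probability (T * T')%type R =>
  L1dist (nu \x nu)%E (fun z => W z.1.1 z.2.1) (fun z => W' z.1.2 z.2.2)).
Local Open Scope ereal_scope.

Let Wp (z : T * T) := W z.1 z.2.
Let Wp' (z : T' * T') := W' z.1 z.2.
Let G : measurableType _ := glueT F.

Let FF : ProperFilter F := ultra_proper.
Let mW : measurable_fun setT Wp. Proof. by case: gW. Qed.
Let mW' : measurable_fun setT Wp'. Proof. by case: gW'. Qed.
Let W0 z : (0 <= Wp z)%R. Proof. by case: gW => _ _ + _; exact. Qed.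
Let W'0 z : (0 <= Wp' z)%R. Proof. by case: gW' => _ _ + _; exact. Qed.

Variable PG : probability G R.
Hypothesis mpl : measure_preserving P PG (inl : T -> G).
Hypothesis mpr : measure_preserving P' PG (inr : T' -> G).

(** Each slice and its partner form one measurable function on [G]. Only the values on [T] are
    recorded; [W'] is reached through a coupling in [glue_approx]. *)
Lemma glue_slices (J : finType) (b : T -> J) : finpart b ->
  exists g : J -> G -> R, (forall j, measurable_fun setT (g j)) /\
    forall j (x : T), g j (inl x) =
      (slice P Wp (b @^-1` [set j]) x / fine (P (b @^-1` [set j])))%R.
Proof.
move=> mb.
have H j := slice_partner UF Fcoupling gW gW' FW (mb j).
pose f' j := sval (cid2 (H j)).
have mf' j : measurable_fun setT (f' j) by rewrite /f'; case: cid2.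
have ff' j : matched F (slice P Wp (b @^-1` [set j])) (f' j) by rewrite /f'; case: cid2.
exists (fun j (s : G) => (glue (slice P Wp (b @^-1` [set j])) (f' j) s /
  fine (P (b @^-1` [set j])))%R); split => // j.
apply: measurable_funM => //; apply: (measurable_glue FF Fcoupling) => //.
by apply: measurable_slice => //; exact: mb.
Qed.

(** The first averaging, over a partition of [T], shows that [W] is close to a function on [T * G],
    whose step approximation provides a partition of [G]. Averaging over that partition gives a
    kernel on [G * G], to be step-approximated in turn. *)
Lemma glue_step_approx (e : R) : (0 < e)%R ->
  exists (I J : finType) (a : G -> I) (b : G -> J) (c : I -> J -> R),
    [/\ finpart a, finpart b &
      L1dist (P \x P) Wp (fun z => c (a (inl z.1)) (b (inl z.2))) < e%:E].
Proof.
(* Two units go to the first average and one to its step approximation; the second averaging doubles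
   these three, and the last approximation adds one: seven units of eight. *)
move=> e0; pose e1 : R := (e / 8)%R.
have e10 : (0 < e1)%R by rewrite divr_gt0.
have iW := graphon_integrable gW.
have Wsym : Wp \o (fun z : T * T => (z.2, z.1)) = Wp.
  by apply/funext => -[x y] /=; rewrite /Wp/=; case: gW.
have [I [J [a [b [c [ma mb abc]]]]]] := step_approxP iW e10.
have [g [mg gE]] := glue_slices mb.
have mavg := measurable_average P mb mW W0.
have Wavg := L1dist_average_lt ma mb mW W0 abc.
(* The variables are exchanged: the averaged one stays in [T], while the variable of the slices
   moves to [G]. *)
pose S (z : T * G) : R := g (b z.1) z.2.
have mS : measurable_fun setT S.
  have mb1 : finpart (fun z : T * G => b z.1).
    by have := finpart_comp (@measurable_fst _ _ T G) mb.
  apply: (@measurable_fun_finpart _ _ _ _ _ (fun j (z : T * G) => g j z.2) mb1) => j.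
  exact: (measurableT_comp (mg j) measurable_snd).
pose il (z : T * T) : T * G := (z.1, inl z.2).
have mpil : measure_preserving (P \x P) (P \x PG) il.
  exact: measure_preserving_prod (measure_preserving_id P) mpl.
have SE : S \o il = average P b Wp \o (fun z : T * T => (z.2, z.1)).
  by apply/funext => z; rewrite /= /S /il/= gE.
(* The symmetry of [W] undoes the exchange of variables. *)
have WS : L1dist (P \x P) Wp (S \o il) < (e1 + e1)%:E.
  by rewrite SE -[X in L1dist _ X _]Wsym (L1dist_mp (measure_preserving_swap P P)).
have mSil : measurable_fun setT (S \o il) by exact: (measurableT_comp mS mpil.1).
(* [S] is integrable because its pull-back is at finite distance from the integrable [W]; the same
   holds for [U] below. *)
have iS : (P \x PG).-integrable setT (EFin \o S).
  apply: (integrable_mp mpil) => //; apply: (L1dist_integrable mSil iW).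
  by rewrite L1distC; apply: lt_trans WS _; rewrite ltry.
have [I' [J' [a' [b' [c' [ma' mb' abc']]]]]] := step_approxP iS e10.
(* The classes of [b'] come from [G], so averaging over its restriction to [T] yields a function
   whose second variable also extends to [G]. *)
have mb'' : finpart (b' \o inl : T -> J') := finpart_comp mpl.1 mb'.
have mst : measurable_fun setT (fun z : T * G => c' (a' z.1) (b' z.2)).
  exact: measurable_step c' ma' mb'.
have mst' : measurable_fun setT (fun z : T * T => c' (a' z.1) ((b' \o inl) z.2)).
  exact: measurable_step c' ma' mb''.
have W3 : L1dist (P \x P) Wp (fun z => c' (a' z.1) ((b' \o inl) z.2)) < (e1 + e1 + e1)%:E.
  apply: le_lt_trans (L1dist_triangle _ mW mSil mst') _.
  by rewrite [ltRHS]EFinD; apply: lteD => //; rewrite -(L1dist_mp mpil) in abc'.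
have Wavg2 := L1dist_average_lt ma' mb'' mW W0 W3.
have mavg2 := measurable_average P mb'' mW W0.
have [g2 [mg2 g2E]] := glue_slices mb''.
pose U (z : G * G) : R := g2 (b' z.2) z.1.
have mU : measurable_fun setT U.
  have mb2 : finpart (fun z : G * G => b' z.2).
    by have := finpart_comp (@measurable_snd _ _ G G) mb'.
  apply: (@measurable_fun_finpart _ _ _ _ _ (fun j (z : G * G) => g2 j z.1) mb2) => j.
  exact: (measurableT_comp (mg2 j) measurable_fst).
pose ll (z : T * T) : G * G := (inl z.1, inl z.2).
have mpll : measure_preserving (P \x P) (PG \x PG) ll.
  exact: measure_preserving_prod mpl mpl.
have UE : U \o ll = average P (b' \o inl) Wp.
  by apply/funext => z; rewrite /= /U /ll/= g2E.
have iU : (PG \x PG).-integrable setT (EFin \o U).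
  apply: (integrable_mp mpll) => //.
  apply: (L1dist_integrable (measurableT_comp mU mpll.1) iW).
  by rewrite UE L1distC; apply: lt_trans Wavg2 _; rewrite ltry.
have [I3 [J3 [a3 [b3 [c3 [ma3 mb3 abc3]]]]]] := step_approxP iU e10.
exists I3, J3, a3, b3, c3; split => //.
have mst3 : measurable_fun setT (fun z : G * G => c3 (a3 z.1) (b3 z.2)).
  exact: measurable_step c3 ma3 mb3.
have mst3' : measurable_fun setT (fun z : T * T => c3 (a3 (inl z.1)) (b3 (inl z.2))).
  exact: (measurableT_comp mst3 mpll.1).
apply: le_lt_trans (L1dist_triangle _ mW mavg2 mst3') _.
rewrite -UE; move: abc3; rewrite -(L1dist_mp mpll)// => abc3.
rewrite UE in abc3 *; apply: lt_le_trans (lteD Wavg2 abc3) _.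
by rewrite -EFinD lee_fin /e1; lra.
Qed.

Let ll (z : T * T) : G * G := (inl z.1, inl z.2).
Let rr (z : T' * T') : G * G := (inr z.1, inr z.2).
Let mpll : measure_preserving (P \x P) (PG \x PG) ll.
Proof. exact: measure_preserving_prod mpl mpl. Qed.
Let mprr : measure_preserving (P' \x P') (PG \x PG) rr.
Proof. exact: measure_preserving_prod mpr mpr. Qed.

Lemma step_mismatch (I J : finType) (a : G -> I) (b : G -> J) (c : I -> J -> R) :
  finpart a -> finpart b ->
  vanishing F (fun nu : probability (T * T')%type R => L1dist (nu \x nu)
    (fun z => c (a (inl z.1.1)) (b (inl z.2.1)))
    (fun z => c (a (inr z.1.2)) (b (inr z.2.2)))).
Proof.
move=> ma mb; have [C C0 cC] := fin_fun2_bound c.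
apply: (@vanishing_le _ _ _ _ _ (fun nu : probability (T * T')%type R =>
  (2 * C)%:E * nu (mismatch a) + (2 * C)%:E * nu (mismatch b))); last first.
  apply: vanishingD; apply: vanishingZ => //; rewrite ?mulr_ge0//.
    exact: (vanishing_mismatch FF Fcoupling).
  exact: (vanishing_mismatch FF Fcoupling).
apply: filterE => nu /=; apply: L1dist_step_le => //.
- exact: (finpart_comp mpl.1 ma).
- exact: (finpart_comp mpr.1 ma).
- exact: (finpart_comp mpl.1 mb).
- exact: (finpart_comp mpr.1 mb).
Qed.

(** One coupling under which both the readings of the step function and the graphons are close leads
    from [U \o rr] to [U \o ll], then to [W] and [W']. *)
Lemma glue_approx (e : R) : (0 < e)%R ->
  exists2 U : G * G -> R, measurable_fun setT U &
    L1dist (P \x P) (U \o ll) Wp < e%:E /\ L1dist (P' \x P') (U \o rr) Wp' < e%:E.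
Proof.
move=> e0; have e3 : (0 < e / 3)%R by rewrite divr_gt0.
have [I [J [a [b [c [ma mb abc]]]]]] := glue_step_approx e3.
pose U (z : G * G) := c (a z.1) (b z.2).
have mU : measurable_fun setT U by exact: measurable_step c ma mb.
exists U => //; split.
  rewrite L1distC; apply: lt_trans abc _; rewrite lte_fin; lra.
have [nu [/= cnu [h1 h2]]] := filter_ex (filterI Fcoupling
  (filterI (step_mismatch c ma mb e3) (FW e3))).
have mp1 := measure_preserving_prod (coupling_fst cnu) (coupling_fst cnu).
have mp2 := measure_preserving_prod (coupling_snd cnu) (coupling_snd cnu).
have mUr : measurable_fun setT (U \o rr) by exact: (measurableT_comp mU mprr.1).
have mUl : measurable_fun setT (U \o ll) by exact: (measurableT_comp mU mpll.1).
have mUr2 := measurableT_comp mUr mp2.1.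
have mUl1 := measurableT_comp mUl mp1.1.
have mW1 := measurableT_comp mW mp1.1.
have mW2 := measurableT_comp mW' mp2.1.
rewrite -(L1dist_mp mp2)//.
apply: le_lt_trans (L1dist_triangle _ mUr2 mUl1 mW2) _.
rewrite (_ : e = e / 3 + (e / 3 + e / 3))%R; last by lra.
rewrite EFinD; apply: lteD; first by rewrite L1distC.
apply: le_lt_trans (L1dist_triangle _ mUl1 mW1 mW2) _.
by rewrite EFinD; apply: lteD => //; rewrite (L1dist_mp mp1)// L1distC.
Qed.

(** Distances on [G * G] are computed on [T * T] through [ll], where the approximations are all near
    [W]; hence they are Cauchy. *)
Lemma glue_limit : exists2 U : G * G -> R, measurable_fun setT U &
  L1dist (P \x P) (U \o ll) Wp = 0 /\ L1dist (P' \x P') (U \o rr) Wp' = 0.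
Proof.
have [||U mU HU] := @L1_complete _ _ _ (PG \x PG) (fun e (U : G * G -> R) =>
  measurable_fun setT U /\
  L1dist (P \x P) (U \o ll) Wp < e%:E /\ L1dist (P' \x P') (U \o rr) Wp' < e%:E).
- by move=> e e0; have [U mU HU] := glue_approx e0; exists U.
- move=> e e' U U' [mU [HU _]] [mU' [HU' _]].
  have mUl := measurableT_comp mU mpll.1; have mUl' := measurableT_comp mU' mpll.1.
  rewrite -(L1dist_mp mpll)//; apply: le_trans (L1dist_triangle _ mUl mW mUl') _.
  by rewrite EFinD; apply: leeD; [|rewrite L1distC]; exact: ltW.
have mUl := measurableT_comp mU mpll.1; have mUr := measurableT_comp mU mprr.1.
exists U => //; split; apply/eqP; rewrite eq_le L1dist_ge0 andbT; apply/lee_addgt0Pr => e e0;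
  rewrite add0e; have e2 : (0 < e / 2)%R by rewrite divr_gt0.
- have [V [e' [mV e'e [_ [HV _]] VU]]] := HU _ e2.
  have mVl := measurableT_comp mV mpll.1.
  apply: le_trans (L1dist_triangle _ mUl mVl mW) _.
  rewrite (splitr e) EFinD; apply: leeD.
    by rewrite (L1dist_mp mpll)// L1distC ltW.
  by apply: ltW; apply: lt_trans HV _; rewrite lte_fin.
- have [V [e' [mV e'e [_ [_ HV]] VU]]] := HU _ e2.
  have mVr := measurableT_comp mV mprr.1.
  apply: le_trans (L1dist_triangle _ mUr mVr mW') _.
  rewrite (splitr e) EFinD; apply: leeD.
    by rewrite (L1dist_mp mprr)// L1distC ltW.
  by apply: ltW; apply: lt_trans HV _; rewrite lte_fin.
Qed.

Lemma glue_equiv : graphon_equiv P P' W W'.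
Proof.
have [U mU [Ul Ur]] := glue_limit.
(* Symmetry and nonnegativity must hold at every point of [G] for a graphon. *)
pose V (s t : G) : R := (`|U (s, t) + U (t, s)| / 2)%R.
have msw := (measure_preserving_swap PG PG).1.
have mV : measurable_fun setT (fun z : G * G => V z.1 z.2).
  rewrite (_ : (fun z => _) = (fun z : G * G => `|U z + U (z.2, z.1)| / 2)%R).
    apply: measurable_funM => //; apply: measurableT_comp => //.
    by apply: measurable_funD => //; exact: (measurableT_comp mU msw).
  by apply/funext => -[s t].
have Wsym x y : Wp (x, y) = Wp (y, x) by rewrite /Wp; case: gW.
have W'sym x y : Wp' (x, y) = Wp' (y, x) by rewrite /Wp'; case: gW'.
have mVl := measurableT_comp mV mpll.1; have mVr := measurableT_comp mV mprr.1.
have Vl : L1dist (P \x P) ((fun z : G * G => V z.1 z.2) \o ll) Wp = 0.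
  by have := L1dist_symmetrize (measurableT_comp mU mpll.1) mW Wsym W0 Ul.
have Vr : L1dist (P' \x P') ((fun z : G * G => V z.1 z.2) \o rr) Wp' = 0.
  by have := L1dist_symmetrize (measurableT_comp mU mprr.1) mW' W'sym W'0 Ur.
exists _, G, PG, V, inl, inr; split => //.
- split => //.
  + by move=> s t; rewrite /V addrC.
  + by move=> s t; rewrite /V divr_ge0.
  + have : (PG \x PG).-integrable setT (EFin \o (fun z : G * G => V z.1 z.2)).
      apply: (integrable_mp mpll) => //.
      by apply: (L1dist_integrable mVl (graphon_integrable gW)); rewrite Vl.
    by move=> /integrableP[_].
- by rewrite L1distC in Vl; have := L1dist_eq0 mW mVl Vl.
- by rewrite L1distC in Vr; have := L1dist_eq0 mW' mVr Vr.
Qed.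

End zero_distance_equiv.

(** The sets of couplings with L^1 distance below [e] form a filter base, nonempty by hypothesis,
    and any ultrafilter containing it serves. *)
Lemma equiv_of_couplings {R : realType} d d' (T : measurableType d)
    (T' : measurableType d') (P : probability T R) (P' : probability T' R)
    (W : T -> T -> R) (W' : T' -> T' -> R) :
  graphon P W -> graphon P' W' ->
  (forall e : R, 0 < e -> exists2 nu : probability (T * T')%type R, coupling P P' nu &
    (L1dist (nu \x nu)%E (fun z => W z.1.1 z.2.1) (fun z => W' z.1.2 z.2.2) < e%:E)%E) ->
  graphon_equiv P P' W W'.
Proof.
move=> gW gW' H.
pose B (e : R) : set (probability (T * T')%type R) := [set nu | coupling P P' nu /\
  (L1dist (nu \x nu)%E (fun z => W z.1.1 z.2.1) (fun z => W' z.1.2 z.2.2) < e%:E)%E].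
pose F0 := filter_from [set e : R | 0 < e] B.
have PF0 : ProperFilter F0.
  apply: filter_from_proper; last by move=> e /= /H[nu cnu nue]; exists nu.
  apply: filter_from_filter; first by exists 1 => /=.
  move=> e e' /= e0 e'0; exists (Num.min e e'); first by rewrite /= lt_min e0.
  by move=> nu [cnu]; rewrite EFin_min lt_min => /andP[h h']; split.
have [F [UF F0F]] := ultraFilterLemma PF0.
have Fc : F [set nu | coupling P P' nu].
  by apply: F0F; exists 1 => //= nu [].
have FW : vanishing F (fun nu : probability (T * T')%type R =>
    L1dist (nu \x nu)%E (fun z => W z.1.1 z.2.1) (fun z => W' z.1.2 z.2.2)).
  by move=> e e0; apply: F0F; exists e => // nu [].
have [PG [mpl mpr]] := glue_probability ultra_proper Fc.
exact: (glue_equiv UF Fc gW gW' FW mpl mpr).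
Qed.

(** * Vanishing cut distance gives L^1-close couplings *)

Section cut_bound.
Context {R : realType} d d' (T : measurableType d) (T' : measurableType d').
Variables (P : probability T R) (P' : probability T' R).
Variables (W : T -> T -> R) (W' : T' -> T' -> R).
Hypothesis gW : graphon P W.
Hypothesis gW' : graphon P' W'.
Local Open Scope ereal_scope.

(** The triangle inequality compares [t] with the mean of [g] on [B], and [average_block] bounds the
    deviation between the two. *)
Lemma block_le d0 (Z : measurableType d0) (Q : probability Z R) (g : Z -> R)
  (B : set Z) (t : R) : measurable_fun setT g -> measurable B ->
  \int[Q]_z (`|t| * \1_B z)%:E <=
    \int[Q]_z (`|g z - t| * \1_B z)%:E + `|\int[Q]_(z in B) (g z)%:E|.
Proof.
move=> mg mB; have QB : Q B = (fine (Q B))%:E by rewrite fineK// fin_num_measure.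
have -> : \int[Q]_z (`|t| * \1_B z)%:E = (`|t| * fine (Q B))%:E.
  under eq_integral do rewrite EFinM.
  rewrite ge0_integralZl_EFin//; last by apply/measurable_EFinP; exact: measurable_indic.
  by rewrite integral_indic// setIT EFinM -QB.
have gE : \int[Q]_(z in B) (g z)%:E = \int[Q]_z (g z * \1_B z)%:E.
  rewrite integral_mkcond; apply: eq_integral => z _.
  by rewrite patchE indicE; case: (z \in B); rewrite ?mulr1 ?mulr0.
have := average_block Q t mg mB; rewrite -gE QB.
set r := fine (Q B); set m := \int[Q]_(z in B) _; set K := \int[Q]_z _ => avg.
have r0 : (0 <= r)%R by rewrite fine_ge0.
have [r00|rN0] := eqVneq r 0%R.
  rewrite r00 mulr0; apply: adde_ge0 => //.
  by apply: integral_ge0 => z _; rewrite lee_fin mulr_ge0.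
apply: (@le_trans _ _ (`|fine m / r - t|%:E * r%:E + `|fine m|%:E)).
  rewrite -EFinM -EFinD lee_fin -lerBlDr.
  apply: (@le_trans _ _ ((`|t| - `|fine m / r|) * r)%R).
    by rewrite mulrBl normrM [X in (_ * X * r)%R]ger0_norm ?invr_ge0// divfK.
  apply: ler_wpM2r => //; rewrite distrC; exact: lerB_dist.
(* For an infinite integral [fine] gives 0, while the right side is [+oo]. *)
apply: leeD => //; case: m {gE avg} => [x||]//=.
by rewrite normr0 leey.
by rewrite normr0 leey.
Qed.

(** The grids are chosen before the coupling, so the cut norm can be made small against the number
    of cells. Each cell is a rectangle, hence the integral of [W - W'] over it is bounded by the cut
    norm, and [block_le] controls the difference of the step functions. *)
Lemma coupling_of_cut (e : R) : delta_cut P P' W W' = 0 -> (0 < e)%R ->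
  exists2 nu : probability (T * T')%type R, coupling P P' nu &
    L1dist (nu \x nu) (fun z => W z.1.1 z.2.1) (fun z => W' z.1.2 z.2.2) < e%:E.
Proof.
move=> cut0 e0; have e8 : (0 < e / 8)%R by rewrite divr_gt0.
have [mW _ _ _] := gW; have [mW' _ _ _] := gW'.
have [I [J [a [b [c [ma mb abc]]]]]] := step_approxP (graphon_integrable gW) e8.
have [I' [J' [a' [b' [c' [ma' mb' abc']]]]]] := step_approxP (graphon_integrable gW') e8.
pose K := ((I * I') * (J * J'))%type.
(* One [eps] for each cell adds up to at most [e / 4]; the [+ 1] keeps the divisor positive. *)
pose eps : R := (e / 4 / (#|{: K}|%:R + 1))%R.
have eps0 : (0 < eps)%R by rewrite !divr_gt0// ltr_wpDl.
have : delta_cut P P' W W' < eps%:E by rewrite cut0 lte_fin.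
move=> /ereal_inf_lt[_ /= [nu cnu <-] supe]; exists nu => //.
have mp1 := measure_preserving_prod (coupling_fst cnu) (coupling_fst cnu).
have mp2 := measure_preserving_prod (coupling_snd cnu) (coupling_snd cnu).
pose W1 (z : (T * T') * (T * T')) := W z.1.1 z.2.1.
pose W2 (z : (T * T') * (T * T')) := W' z.1.2 z.2.2.
pose c1 (z : (T * T') * (T * T')) := c (a z.1.1) (b z.2.1).
pose c2 (z : (T * T') * (T * T')) := c' (a' z.1.2) (b' z.2.2).
have mc := measurable_step c ma mb; have mc' := measurable_step c' ma' mb'.
have mW1 : measurable_fun setT W1 by exact: (measurableT_comp mW mp1.1).
have mW2 : measurable_fun setT W2 by exact: (measurableT_comp mW' mp2.1).
have mc1 : measurable_fun setT c1 by exact: (measurableT_comp mc mp1.1).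
have mc2 : measurable_fun setT c2 by exact: (measurableT_comp mc' mp2.1).
have H1 : L1dist (nu \x nu) W1 c1 < (e / 8)%:E by rewrite -(L1dist_mp mp1) in abc.
have H2 : L1dist (nu \x nu) W2 c2 < (e / 8)%:E by rewrite -(L1dist_mp mp2) in abc'.
pose alpha (z : T * T') : I * I' := (a z.1, a' z.2).
pose beta (z : T * T') : J * J' := (b z.1, b' z.2).
have malpha : finpart alpha.
  apply: finpart_pair.
    by have := finpart_comp (@measurable_fst _ _ T T') ma.
  by have := finpart_comp (@measurable_snd _ _ T T') ma'.
have mbeta : finpart beta.
  apply: finpart_pair.
    by have := finpart_comp (@measurable_fst _ _ T T') mb.
  by have := finpart_comp (@measurable_snd _ _ T T') mb'.
pose gam (z : (T * T') * (T * T')) : K := (alpha z.1, beta z.2).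
have mgam : finpart gam.
  apply: finpart_pair.
    by have := finpart_comp (@measurable_fst _ _ (T * T')%type (T * T')%type) malpha.
  by have := finpart_comp (@measurable_snd _ _ (T * T')%type (T * T')%type) mbeta.
pose D (k : K) : R := (c k.1.1 k.2.1 - c' k.1.2 k.2.2)%R.
have mW12 : measurable_fun setT (fun z => (W1 z - W2 z)%R) by exact: measurable_funB.
have blk k : `|\int[nu \x nu]_(z in gam @^-1` [set k]) (W1 z - W2 z)%:E| <= eps%:E.
  apply: le_trans (ltW supe); apply: ereal_sup_ubound.
  exists (alpha @^-1` [set k.1]), (beta @^-1` [set k.2]); split => //.
  rewrite (_ : gam @^-1` [set k] = alpha @^-1` [set k.1] `*` beta @^-1` [set k.2])//.
  by case: k => k1 k2; apply/seteqP; split => z /=; [case|move=> [/= <- <-]].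
have step : L1dist (nu \x nu) c1 c2 <=
    L1dist (nu \x nu) (fun z => W1 z - W2 z)%R (fun z => c1 z - c2 z)%R + (e / 4)%:E.
  have -> : L1dist (nu \x nu) c1 c2 = \int[nu \x nu]_z (`|D (gam z)|)%:E by [].
  rewrite (integral_finpart (nu \x nu) (G := fun k _ => `|D k|%R) mgam)//.
  have -> : L1dist (nu \x nu) (fun z => W1 z - W2 z)%R (fun z => c1 z - c2 z)%R =
     \int[nu \x nu]_z (`|(W1 z - W2 z) - D (gam z)|)%:E by [].
  rewrite (integral_finpart (nu \x nu) (G := fun k z => `|(W1 z - W2 z) - D k|%R) mgam)//;
    last by move=> k; apply: measurableT_comp => //; exact: measurable_funB.
  apply: (@le_trans _ _ (\sum_k (\int[nu \x nu]_z
      (`|(W1 z - W2 z) - D k| * \1_(gam @^-1` [set k]) z)%:E + eps%:E))).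
    apply: lee_sum => k _; apply: le_trans (block_le _ _ mW12 (mgam k)) _.
    by apply: leeD => //; exact: blk.
  rewrite big_split/=; apply: leeD => //.
  rewrite sumEFin lee_fin sumr_const -[leLHS]mulr_natr.
  rewrite (_ : #|xpredT| = #|{: K}|); last by apply: eq_card.
  rewrite /eps -[leLHS]mulrA ler_piMr//.
    by rewrite divr_ge0// ltW.
  by rewrite mulrC ler_pdivrMr ?ltr_wpDl// mul1r lerDl.
have diff : L1dist (nu \x nu) (fun z => W1 z - W2 z)%R (fun z => c1 z - c2 z)%R <=
    L1dist (nu \x nu) W1 c1 + L1dist (nu \x nu) W2 c2.
  have m1 := measurable_L1 mW1 mc1; have m2 := measurable_L1 mW2 mc2.
  rewrite /L1dist -ge0_integralD//; apply: le_L1dist => //.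
  - exact: measurable_funB.
  - exact: emeasurable_funD.
  move=> z; rewrite -EFinD lee_fin.
  rewrite (_ : _ - _ = (W1 z - c1 z) - (W2 z - c2 z))%R; last by ring.
  exact: ler_normB.
apply: le_lt_trans (L1dist_triangle _ mW1 mc1 mW2) _.
(* The shares are: [W] to its step function; both step errors plus the cells, for the step
   functions; and the return to [W'], which takes up the slack. *)
have -> : e = (e / 8 + (((e / 8 + e / 8) + e / 4) + 3 * e / 8))%R by lra.
rewrite EFinD; apply: lteD => //.
apply: le_lt_trans (L1dist_triangle _ mc1 mc2 mW2) _.
rewrite EFinD; apply: lee_ltD => //; last first.
- by rewrite L1distC; apply: lt_trans H2 _; rewrite lte_fin; lra.
- apply: le_trans step _; rewrite [leRHS]EFinD; apply: leeD => //.
  by apply: le_trans diff _; rewrite EFinD; apply: leeD; exact: ltW.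
rewrite ge0_fin_numE ?L1dist_ge0//; apply: le_lt_trans step _.
apply: lte_add_pinfty; rewrite ?ltry//; apply: le_lt_trans diff _.
by apply: lte_add_pinfty; [exact: lt_trans H1 (ltry _)|exact: lt_trans H2 (ltry _)].
Qed.

End cut_bound.

(** * From a common factor to L^1-close couplings *)

Section common_factor_coupling.
Context {R : realType}.
Local Open Scope ereal_scope.

Lemma density_probability d (Z : measurableType d) (Q : probability Z R) (g : Z -> R) :
  measurable_fun setT g -> (forall z, 0 <= g z)%R -> \int[Q]_z (g z)%:E = 1 ->
  exists nu : probability Z R, forall A, measurable A -> nu A = \int[Q]_(z in A) (g z)%:E.
Proof.
move=> mg g0 g1; pose m (A : set Z) := \int[Q]_(z in A) (g z)%:E.
have m0 : m set0 = 0 by rewrite /m integral_set0.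
have mge0 A : 0 <= m A by apply: integral_ge0 => z _; rewrite lee_fin.
have msa : semi_sigma_additive m.
  move=> A mA tA mUA.
  have mgA : measurable_fun (\bigcup_k A k) (fun z => (g z)%:E).
    by apply: (measurable_funS measurableT) => //; exact/measurable_EFinP.
  rewrite /m ge0_integral_bigcup//; last by move=> z _; rewrite lee_fin.
  by apply: is_cvg_ereal_nneg_natsum => n _; exact: mge0.
pose mu : {measure set Z -> \bar R} := HB.pack m (isMeasure.Build _ _ _ m m0 mge0 msa).
have mu1 : mu setT = 1 by exact: g1.
pose nu : probability Z R := HB.pack (mu : set Z -> \bar R)
  (Measure.on mu) (Measure_isProbability.Build _ _ _ mu mu1).
by exists nu.
Qed.

(* Within each class of the partition the coupling is the product of the two
   conditional measures; classes of measure zero get the junk weight [0^-1 = 0]. *)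
Lemma partition_coupling d d' d'' (T : measurableType d) (T' : measurableType d')
  (T'' : measurableType d'') (P : probability T R) (P' : probability T' R)
  (Q : probability T'' R) (phi : T -> T'') (phi' : T' -> T'') (K : finType) (k : T'' -> K) :
  measure_preserving P Q phi -> measure_preserving P' Q phi' -> finpart k ->
  exists2 nu : probability (T * T')%type R, coupling P P' nu &
    nu [set z | k (phi z.1) != k (phi' z.2)] = 0.
Proof.
move=> [mphi Pphi] [mphi' P'phi'] mk.
pose X i := phi @^-1` (k @^-1` [set i]); pose X' i := phi' @^-1` (k @^-1` [set i]).
have mX i : measurable (X i) by exact: (finpart_comp mphi mk).
have mX' i : measurable (X' i) by exact: (finpart_comp mphi' mk).
pose q i := fine (Q (k @^-1` [set i])).
have q0 i : (0 <= q i)%R by rewrite fine_ge0.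
have qE i : Q (k @^-1` [set i]) = (q i)%:E by rewrite fineK// fin_num_measure//; exact: mk.
have PX i : P (X i) = (q i)%:E by rewrite Pphi ?qE//; exact: mk.
have P'X' i : P' (X' i) = (q i)%:E by rewrite P'phi' ?qE//; exact: mk.
pose g (z : T * T') : R := (\sum_i (q i)^-1 * \1_(X i `*` X' i) z)%R.
have mXX i : measurable (X i `*` X' i) by exact: measurableX.
have mg : measurable_fun setT g.
  by apply: measurable_sum => i; apply: measurable_funM => //; exact: measurable_indic.
have g0 z : (0 <= g z)%R by apply: sumr_ge0 => i _; rewrite mulr_ge0 ?invr_ge0.
have gE A : measurable A -> \int[P \x P']_(z in A) (g z)%:E =
    \sum_i ((q i)^-1)%:E * (P \x P') (X i `*` X' i `&` A).
  move=> mA; rewrite /g.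
  under eq_integral do rewrite -sumEFin.
  have mi i : measurable_fun A (fun z => (\1_(X i `*` X' i) z)%:E : \bar R).
    by apply/measurable_EFinP; exact: measurable_indic.
  rewrite ge0_integral_sum//.
  - apply: eq_bigr => i _; under eq_integral do rewrite EFinM.
    by rewrite ge0_integralZl_EFin ?invr_ge0// integral_indic.
  - by move=> i; apply/measurable_EFinP; apply: measurable_funM => //; exact: measurable_indic.
  - by move=> i z _; rewrite lee_fin mulr_ge0// invr_ge0.
(* If [q i] is 0, the bound forces [x] to be 0, and the junk inverse does no harm. *)
have qK i x : 0 <= x -> x <= (q i)%:E -> ((q i)^-1)%:E * (x * (q i)%:E) = x.
  move=> x0 xq; have xf : x \is a fin_num.
    by rewrite ge0_fin_numE// (le_lt_trans xq) ?ltry.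
  rewrite -(fineK xf) -!EFinM; congr EFin.
  have [qi0|qi0] := eqVneq (q i) 0%R; last by rewrite mulrC mulfK.
  have : x <= 0 by rewrite -[0]/(0%R%:E) -qi0.
  by rewrite qi0 !mulr0 => x00; have -> : x = 0 by apply/eqP; rewrite eq_le x00.
have sum1 A : measurable A -> \sum_i P (A `&` X i) = P A.
  move=> mA; have m1A : measurable_fun setT (\1_A : T -> R) by exact: measurable_indic.
  have p1A (i : K) x : (0 <= \1_A x :> R)%R by [].
  have := integral_finpart P (finpart_comp mphi mk) (fun=> m1A) p1A.
  rewrite integral_indic// setIT => ->; apply: eq_bigr => i _.
  rewrite (eq_integral (fun x => (\1_(A `&` X i) x)%:E)); last first.
    by move=> x _; rewrite !indicE in_setI -natrM mulnb.
  by rewrite integral_indic ?setIT//; exact: measurableI.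
have sum2 A : measurable A -> \sum_i P' (A `&` X' i) = P' A.
  move=> mA; have m1A : measurable_fun setT (\1_A : T' -> R) by exact: measurable_indic.
  have p1A (i : K) x : (0 <= \1_A x :> R)%R by [].
  have := integral_finpart P' (finpart_comp mphi' mk) (fun=> m1A) p1A.
  rewrite integral_indic// setIT => ->; apply: eq_bigr => i _.
  rewrite (eq_integral (fun x => (\1_(A `&` X' i) x)%:E)); last first.
    by move=> x _; rewrite !indicE in_setI -natrM mulnb.
  by rewrite integral_indic ?setIT//; exact: measurableI.
have marg1 A : measurable A -> \int[P \x P']_(z in A `*` setT) (g z)%:E = P A.
  move=> mA; rewrite gE; last exact: measurableX.
  rewrite -sum1//; apply: eq_bigr => i _; rewrite -setXI setIT.
  have le_q : P (A `&` X i) <= (q i)%:E.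
    by rewrite -PX le_measure ?inE//; exact: measurableI.
  rewrite -[RHS](qK i _ (measure_ge0 _ _) le_q) -P'X'; congr (_ * _).
  by apply: etrans (product_measure1E _ _ (measurableI _ _ (mX i) mA) (mX' i)) _; rewrite setIC.
have marg2 A : measurable A -> \int[P \x P']_(z in setT `*` A) (g z)%:E = P' A.
  move=> mA; rewrite gE; last exact: measurableX.
  rewrite -sum2//; apply: eq_bigr => i _; rewrite -setXI setIT.
  have le_q : P' (A `&` X' i) <= (q i)%:E.
    by rewrite -P'X' le_measure ?inE//; exact: measurableI.
  rewrite -[RHS](qK i _ (measure_ge0 _ _) le_q) -PX; congr (_ * _).
  apply: etrans (product_measure1E _ _ (mX i) (measurableI _ _ (mX' i) mA)) _.
  by rewrite [X' i `&` A]setIC; exact: muleC.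
have tot : \int[P \x P']_z (g z)%:E = 1.
  by rewrite -setXTT marg1// probability_setT.
have [nu nuE] := density_probability mg g0 tot.
exists nu.
  by split => A mA; rewrite nuE; [exact: marg1|exact: measurableX|exact: marg2|exact: measurableX].
have mM : measurable [set z | k (phi z.1) != k (phi' z.2)].
  (* The two labellings are read as one labelling of the disjoint union. *)
  apply: (@measurable_mismatch _ _ T T' K (fun s => match s with
    inl x => k (phi x) | inr x => k (phi' x) end)).
    exact: (finpart_comp mphi mk).
  exact: (finpart_comp mphi' mk).
rewrite nuE// gE// big1// => i _; rewrite (_ : _ `&` _ = set0) ?measure0 ?mule0//.
by apply/seteqP; split => // z [[/= -> ->]]; rewrite eqxx.
Qed.

Lemma ae_L1dist0 d (X : measurableType d) (Q : probability X R) (f g : X -> R) :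
  measurable_fun setT f -> measurable_fun setT g ->
  {ae Q, forall x, f x = g x} -> L1dist Q f g = 0.
Proof.
move=> mf mg fg.
have m : measurable_fun setT (fun x => (f x - g x)%:E : \bar R).
  by apply/measurable_EFinP; exact: measurable_funB.
apply: (ae_eq_integral_abs Q measurableT m).2.
by apply: filterS fg => x /= -> _; rewrite subrr.
Qed.

(** The pull-backs of a step approximation of [U] are close to [W] and to [W']. The coupling is
    concentrated on pairs with equal labels, where the two pull-backs coincide. *)
Lemma coupling_of_equiv d d' (T : measurableType d) (T' : measurableType d')
  (P : probability T R) (P' : probability T' R)
  (W : T -> T -> R) (W' : T' -> T' -> R) (e : R) :
  graphon P W -> graphon P' W' -> graphon_equiv P P' W W' -> (0 < e)%R ->
  exists2 nu : probability (T * T')%type R, coupling P P' nu &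
    L1dist (nu \x nu) (fun z => W z.1.1 z.2.1) (fun z => W' z.1.2 z.2.2) < e%:E.
Proof.
move=> [mW _ _ _] [mW' _ _ _] [d'' [T'' [Q [U [phi [phi' [gU mp mp' WU W'U]]]]]]] e0.
have e2 : (0 < e / 2)%R by rewrite divr_gt0.
have [mU _ _ _] := gU.
have [I [J [a [b [c [ma mb abc]]]]]] := step_approxP (graphon_integrable gU) e2.
(* Joint labels, so that one coupling matches the partitions of both variables. *)
pose k (s : T'') : I * J := (a s, b s).
have mk : finpart k by exact: finpart_pair.
have [nu cnu nu0] := partition_coupling mp mp' mk; exists nu => //.
have mc := measurable_step c ma mb.
have mpp := measure_preserving_prod mp mp; have mpp' := measure_preserving_prod mp' mp'.
have mp1 := measure_preserving_prod (coupling_fst cnu) (coupling_fst cnu).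
have mp2 := measure_preserving_prod (coupling_snd cnu) (coupling_snd cnu).
have mUp := measurableT_comp mU mpp.1; have mUp' := measurableT_comp mU mpp'.1.
have mcp := measurableT_comp mc mpp.1; have mcp' := measurableT_comp mc mpp'.1.
have WU0 := ae_L1dist0 mW mUp WU; have W'U0 := ae_L1dist0 mW' mUp' W'U.
have Wc : L1dist (P \x P) (fun z => W z.1 z.2) (fun z => c (a (phi z.1)) (b (phi z.2))) < (e / 2)%:E.
  apply: le_lt_trans (L1dist_triangle _ mW mUp mcp) _.
  by rewrite WU0 add0e (L1dist_mp mpp).
have Wc' : L1dist (P' \x P') (fun z => W' z.1 z.2)
    (fun z => c (a (phi' z.1)) (b (phi' z.2))) < (e / 2)%:E.
  apply: le_lt_trans (L1dist_triangle _ mW' mUp' mcp') _.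
  by rewrite W'U0 add0e (L1dist_mp mpp').
have [C C0 cC] := fin_fun2_bound c.
pose aa (s : glued T T') := match s with inl x => a (phi x) | inr x => a (phi' x) end.
pose bb (s : glued T T') := match s with inl x => b (phi x) | inr x => b (phi' x) end.
have f1 : finpart (fun x : T => aa (inl x)) by exact: (finpart_comp mp.1 ma).
have f2 : finpart (fun x : T' => aa (inr x)) by exact: (finpart_comp mp'.1 ma).
have f3 : finpart (fun x : T => bb (inl x)) by exact: (finpart_comp mp.1 mb).
have f4 : finpart (fun x : T' => bb (inr x)) by exact: (finpart_comp mp'.1 mb).
have mM : measurable [set z : T * T' | k (phi z.1) != k (phi' z.2)].
  apply: (@measurable_mismatch _ _ T T' _ (fun s => match s with
    inl x => k (phi x) | inr x => k (phi' x) end)).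
    exact: (finpart_comp mp.1 mk).
  exact: (finpart_comp mp'.1 mk).
have nua : nu (mismatch aa) = 0.
  apply/eqP; rewrite eq_le measure_ge0 andbT -nu0 le_measure ?inE//.
    exact: measurable_mismatch.
  by move=> z /=; apply: contra => /eqP[] /= ->.
have nub : nu (mismatch bb) = 0.
  apply/eqP; rewrite eq_le measure_ge0 andbT -nu0 le_measure ?inE//.
    exact: measurable_mismatch.
  by move=> z /=; apply: contra => /eqP[] /= _ ->.
have := L1dist_step_le nu cC f1 f2 f3 f4; rewrite nua nub !mule0 adde0 => cc.
have mW1 := measurableT_comp mW mp1.1; have mW2 := measurableT_comp mW' mp2.1.
have mc1 := measurableT_comp mcp mp1.1; have mc2 := measurableT_comp mcp' mp2.1.
apply: le_lt_trans (L1dist_triangle _ mW1 mc1 mW2) _.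
rewrite (splitr e) EFinD; apply: lteD; first by rewrite (L1dist_mp mp1).
apply: le_lt_trans (L1dist_triangle _ mc1 mc2 mW2) _.
apply: le_lt_trans (leeD cc (lexx _)) _; rewrite add0e L1distC.
by rewrite (L1dist_mp mp2).
Qed.

End common_factor_coupling.

(** * Comparison of the cut, L^1 and L^p distances *)

Section distances.
Context {R : realType} d d' (T : measurableType d) (T' : measurableType d').
Variables (P : probability T R) (P' : probability T' R).
Variables (W : T -> T -> R) (W' : T' -> T' -> R).
Hypothesis gW : graphon P W.
Hypothesis gW' : graphon P' W'.
Local Open Scope ereal_scope.

(** The vanishing of the L^1 distance, stated by couplings: the middle term of every implication. *)
Definition L1_couplings := forall e : R, (0 < e)%R ->
  exists2 nu : probability (T * T')%type R, coupling P P' nu &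
    L1dist (nu \x nu) (fun z => W z.1.1 z.2.1) (fun z => W' z.1.2 z.2.2) < e%:E.

Lemma coupled_measurable (nu : probability (T * T')%type R) : coupling P P' nu ->
  measurable_fun setT (fun z : (T * T') * (T * T') => W z.1.1 z.2.1) /\
  measurable_fun setT (fun z : (T * T') * (T * T') => W' z.1.2 z.2.2).
Proof.
move=> cnu; have [mW _ _ _] := gW; have [mW' _ _ _] := gW'.
have mp1 := measure_preserving_prod (coupling_fst cnu) (coupling_fst cnu).
have mp2 := measure_preserving_prod (coupling_snd cnu) (coupling_snd cnu).
by split; [exact: (measurableT_comp mW mp1.1)|exact: (measurableT_comp mW' mp2.1)].
Qed.

Lemma delta_cut0 : L1_couplings -> delta_cut P P' W W' = 0.
Proof.
move=> H; apply/eqP; rewrite eq_le; apply/andP; split.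
  apply/lee_addgt0Pr => e e0; rewrite add0e; have [nu cnu nue] := H _ e0.
  have [m1 m2] := coupled_measurable cnu.
  have mB := measurable_funB m1 m2.
  apply: ge_ereal_inf; eexists; first by exists nu.
  apply: ge_ereal_sup => _ [S [U [mS mU ->]]]; apply: le_trans (ltW nue).
  have mSU : measurable (S `*` U) by exact: measurableX.
  apply: le_trans (le_abse_integral _ mSU _) _.
    by apply: (measurable_funS measurableT) => //; exact/measurable_EFinP.
  apply: ge0_subset_integral => //; exact: measurable_L1.
(* Empty sets give the value 0, so every supremum is nonnegative. *)
apply/ereal_infP => _ [nu cnu <-]; apply: ereal_sup_ubound.
exists set0, set0; split => //.
by rewrite set0X integral_set0 abse0.
Qed.

(** For t > eps, t is t^(1-p) t^p, and t^(1-p) is at most eps^(1-p) since 1 - p <= 0. Integrated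
    over a probability space, this stands in for Jensen's inequality. *)
Lemma le_scaled_powR (t eps p : R) : (0 <= t)%R -> (0 < eps)%R -> (1 <= p)%R ->
  (t <= eps + eps `^ (1 - p) * t `^ p)%R.
Proof.
move=> t0 eps0 p1; have p0 : (0 < p)%R by exact: lt_le_trans p1.
have [te|et] := leP t eps; first by rewrite (le_trans te)// lerDl mulr_ge0 ?powR_ge0.
apply: (@le_trans _ _ (eps `^ (1 - p) * t `^ p)%R); last by rewrite lerDr ltW.
rewrite -(@mulr_powRB1 _ t p)// mulrCA ler_peMr// -opprB powRN.
rewrite mulrC ler_pdivlMr ?powR_gt0// mul1r.
by apply: ge0_ler_powR; rewrite ?nnegrE ?subr_ge0 ?(ltW eps0) ?(ltW et).
Qed.

Lemma L1_of_delta_p (p : R) : (1 <= p)%R -> delta_p P P' p W W' = 0 -> L1_couplings.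
Proof.
move=> p1 dp0 e e0; have p0 : (0 < p)%R by exact: lt_le_trans p1.
have e4 : (0 < e / 4)%R by rewrite divr_gt0.
have : delta_p P P' p W W' < (e / 4)%:E by rewrite dp0 lte_fin.
move=> /ereal_inf_lt[_ /= [nu cnu <-]]; set X := \int[_]_z _ => Xe.
exists nu => //; have [m1 m2] := coupled_measurable cnu.
have X0 : 0 <= X by apply: integral_ge0 => z _; rewrite lee_fin powR_ge0.
have XE : X <= ((e / 4) `^ p)%:E.
  have <- : (X `^ p^-1) `^ p = X by rewrite -poweRrM mulVf ?gt_eqF// poweRe1.
  rewrite -poweR_EFin.
  apply: gt0_ler_poweR; rewrite ?in_itv/= ?leey ?andbT ?poweR_ge0//.
  - exact: ltW.
  - by rewrite lee_fin ltW.
  - exact: ltW.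
have mD : measurable_fun setT (fun z : (T * T') * (T * T') =>
    `|W z.1.1 z.2.1 - W' z.1.2 z.2.2|%R).
  by apply: measurableT_comp => //; exact: measurable_funB.
have mp : measurable_fun setT (fun z : (T * T') * (T * T') =>
    (`|W z.1.1 z.2.1 - W' z.1.2 z.2.2| `^ p)%:E).
  by apply/measurable_EFinP; exact: (measurableT_comp (measurable_powR p) mD).
have c0 : (0 <= (e / 4) `^ (1 - p))%R by exact: powR_ge0.
(* As [X] is at most (e/4)^p, the second term is again at most e/4. *)
apply: (@le_lt_trans _ _ ((e / 4)%:E + ((e / 4) `^ (1 - p))%:E * X)).
  have mcp : measurable_fun setT (fun z : (T * T') * (T * T') =>
      ((e / 4) `^ (1 - p))%:E * (`|W z.1.1 z.2.1 - W' z.1.2 z.2.2| `^ p)%:E).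
    exact: measurable_funeM.
  have e40 (z : (T * T') * (T * T')) : setT z -> 0 <= (e / 4)%:E by rewrite lee_fin ltW.
  have cp0 (z : (T * T') * (T * T')) : setT z -> 0 <= ((e / 4) `^ (1 - p))%:E *
      (`|W z.1.1 z.2.1 - W' z.1.2 z.2.2| `^ p)%:E.
    by rewrite -EFinM lee_fin mulr_ge0 ?powR_ge0.
  rewrite /X -ge0_integralZl_EFin//.
  rewrite -[X in X + _](integral_cst_probability (nu \x nu)) -ge0_integralD//.
  apply: le_L1dist => //.
    by apply: emeasurable_funD => //; exact: measurable_funeM.
  by move=> z; rewrite -EFinM -EFinD lee_fin le_scaled_powR.
apply: (@le_lt_trans _ _ ((e / 4)%:E + (e / 4)%:E)); last first.
  by rewrite -EFinD lte_fin; lra.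
apply: leeD => //; apply: le_trans (lee_wpmul2l _ XE) _; first by rewrite lee_fin.
rewrite -EFinM lee_fin -powRD; last by rewrite (gt_eqF e4) implybT.
by rewrite subrK powRr1// ltW.
Qed.

(** Dominated convergence with bound |V|^p: at each point the indicator is eventually 0. *)
Lemma Lp_tail d0 (X : measurableType d0) (Q : probability X R) (V : X -> X -> R) (p e : R) :
  graphon Q V -> Lp_pow Q p V < +oo -> (0 < e)%R ->
  exists n : nat, \int[Q \x Q]_z
    (`|V z.1 z.2| `^ p * \1_[set z : X * X | n%:R < V z.1 z.2] z)%:E < e%:E.
Proof.
move=> [mV _ _ _] iV e0.
have mVp : measurable_fun setT (fun z : X * X => `|V z.1 z.2| `^ p)%R.
  by apply: (measurableT_comp (measurable_powR p)); exact: measurableT_comp.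
have mA (n : nat) : measurable [set z : X * X | (n%:R < V z.1 z.2)%R].
  rewrite -[X in measurable X]setTI.
  rewrite (_ : [set z | _] = (fun z => V z.1 z.2) @^-1` [set` `]n%:R, +oo[%R]); first exact: mV.
  by apply/seteqP; split => z; rewrite /= in_itv/= andbT.
have cvg : \int[Q \x Q]_z (`|V z.1 z.2| `^ p *
    \1_[set z : X * X | n%:R < V z.1 z.2] z)%:E @[n --> \oo] --> \int[Q \x Q]_z (cst 0 z : \bar R).
  apply: (@dominated_cvg _ _ _ (Q \x Q) setT measurableT
    (fun n z => (`|V z.1 z.2| `^ p * \1_[set z : X * X | n%:R < V z.1 z.2] z)%:E)
    (cst 0) (fun z => (`|V z.1 z.2| `^ p)%:E)) => //.
  - by move=> n; apply/measurable_EFinP; apply: measurable_funM => //; exact: measurable_indic.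
  - move=> z _; apply: cvg_near_cst.
    exists (Num.truncn (`|V z.1 z.2|)%R).+1 => // n /= ln.
    rewrite indicE memNset ?mulr0//=; apply/negP; rewrite -leNgt.
    apply: le_trans (ler_norm _) _; apply: ltW.
    by apply: lt_le_trans (truncnS_gt _) _; rewrite ler_nat.
  - apply/integrableP; split; first exact/measurable_EFinP.
    rewrite (_ : \int[_]_x _ = Lp_pow Q p V)//; apply: eq_integral => z _ /=.
    by rewrite ger0_norm// powR_ge0.
  - move=> n z _; rewrite lee_fin normrM ger0_norm ?powR_ge0// ler_piMr ?powR_ge0//.
    by rewrite indicE; case: (_ \in _); rewrite ?normr1 ?normr0.
by move: cvg; rewrite integral0 => /ecvg0_lt/(_ e0).
Qed.

(** If |x - y| <= K, then |x - y|^(p-1) is at most K^(p-1). Otherwise the larger of x and y exceeds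
    K, hence its threshold, and it is at least |x - y|. *)
Lemma powR_dist_le (x y K m n p : R) : (0 <= x)%R -> (0 <= y)%R -> (0 < K)%R ->
  (m <= K)%R -> (n <= K)%R -> (1 <= p)%R ->
  (`|x - y| `^ p <= K `^ (p - 1) * `|x - y| +
    (`|x| `^ p * (m < x)%R%:R + `|y| `^ p * (n < y)%R%:R))%R.
Proof.
move=> x0 y0 K0 mK nK p1; have p0 : (0 < p)%R by exact: lt_le_trans p1.
have t0 : (0 <= `|x| `^ p * (m < x)%R%:R + `|y| `^ p * (n < y)%R%:R)%R.
  by rewrite addr_ge0// mulr_ge0// powR_ge0.
have [dK|Kd] := leP `|x - y|%R K.
  apply: (@le_trans _ _ (K `^ (p - 1) * `|x - y|)%R); last by rewrite lerDl.
  rewrite -mulr_powRB1// mulrC ler_wpM2r//.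
  by apply: ge0_ler_powR; rewrite ?nnegrE ?subr_ge0// ltW.
apply: (@le_trans _ _ (`|x| `^ p * (m < x)%R%:R + `|y| `^ p * (n < y)%R%:R)%R); last first.
  by rewrite lerDr mulr_ge0// powR_ge0.
have pm (u v : R) : (0 <= u)%R -> (u <= v)%R -> (u `^ p <= v `^ p)%R.
  move=> u0 uv; apply: ge0_ler_powR; rewrite ?nnegrE// ?(ltW p0)//.
  exact: le_trans uv.
rewrite (ger0_norm x0) (ger0_norm y0).
have [xy|xy] := leP y x.
  have dx : (`|x - y| <= x)%R by rewrite ger0_norm ?subr_ge0// lerBlDr lerDl.
  have -> : (m < x)%R by rewrite (le_lt_trans mK)// (lt_le_trans Kd).
  by rewrite mulr1 (le_trans (pm _ _ _ dx))// lerDl mulr_ge0 ?powR_ge0.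
have dy : (`|x - y| <= y)%R by rewrite distrC ger0_norm ?subr_ge0 ?(ltW xy)// lerBlDr lerDl.
have -> : (n < y)%R by rewrite (le_lt_trans nK)// (lt_le_trans Kd).
by rewrite mulr1 (le_trans (pm _ _ _ dy))// lerDr mulr_ge0 ?powR_ge0.
Qed.

(** Truncation: the thresholds [m] and [n] come from the tails of the p-th powers, then [K] is
    chosen, and the coupling last, since its L^1 distance must outweigh K^(p-1). *)
Lemma delta_p0 (p : R) : (1 <= p)%R -> Lp_pow P p W < +oo -> Lp_pow P' p W' < +oo ->
  L1_couplings -> delta_p P P' p W W' = 0.
Proof.
move=> p1 WL W'L H; have p0 : (0 < p)%R by exact: lt_le_trans p1.
apply/eqP; rewrite eq_le; apply/andP; split; last first.
  by apply/ereal_infP => _ [nu cnu <-]; exact: poweR_ge0.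
apply/lee_addgt0Pr => e e0; rewrite add0e.
have [mW _ W0 _] := gW; have [mW' _ W'0 _] := gW'.
(* The infimum runs over p-th roots, so the integral has to be at most e^p. *)
pose eta : R := (e `^ p)%R; have eta0 : (0 < eta)%R by rewrite powR_gt0.
have eta4 : (0 < eta / 4)%R by rewrite divr_gt0.
have [m tm] := Lp_tail gW WL eta4; have [n tn] := Lp_tail gW' W'L eta4.
pose K : R := ((maxn m n).+1%:R)%R.
have K0 : (0 < K)%R by rewrite ltr0n.
have mK : (m%:R <= K)%R by rewrite ler_nat (leq_trans (leq_maxl m n)).
have nK : (n%:R <= K)%R by rewrite ler_nat (leq_trans (leq_maxr m n)).
have Kp0 : (0 < K `^ (p - 1))%R by rewrite powR_gt0.
(* After multiplication by K^(p-1) this gives eta/2; each tail adds at most eta/4. *)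
have del0 : (0 < eta / 2 / K `^ (p - 1))%R by rewrite !divr_gt0.
have [nu cnu nue] := H _ del0; have [m1 m2] := coupled_measurable cnu.
apply: ge_ereal_inf; eexists; first by exists nu.
set X := \int[_]_z _.
have X0 : 0 <= X by apply: integral_ge0 => z _; rewrite lee_fin powR_ge0.
suff XE : X <= eta%:E.
  apply: (@le_trans _ _ (eta%:E `^ p^-1)).
    apply: gt0_ler_poweR; rewrite ?in_itv/= ?leey ?andbT ?invr_ge0 ?(ltW p0)//.
    by rewrite lee_fin ltW.
  by rewrite poweR_EFin lee_fin /eta -powRrM mulfV ?gt_eqF// powRr1// ltW.
have mp1 := measure_preserving_prod (coupling_fst cnu) (coupling_fst cnu).
have mp2 := measure_preserving_prod (coupling_snd cnu) (coupling_snd cnu).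
pose A := [set z : T * T | (m%:R < W z.1 z.2)%R].
pose B := [set z : T' * T' | (n%:R < W' z.1 z.2)%R].
have mA : measurable A.
  rewrite -[X in measurable X]setTI.
  rewrite (_ : A = (fun z => W z.1 z.2) @^-1` [set` `]m%:R, +oo[%R]); first exact: mW.
  by apply/seteqP; split => z; rewrite /A /= in_itv/= andbT.
have mB : measurable B.
  rewrite -[X in measurable X]setTI.
  rewrite (_ : B = (fun z => W' z.1 z.2) @^-1` [set` `]n%:R, +oo[%R]); first exact: mW'.
  by apply/seteqP; split => z; rewrite /B /= in_itv/= andbT.
pose f (z : T * T) : \bar R := (`|W z.1 z.2| `^ p * \1_A z)%:E.
pose g (z : T' * T') : \bar R := (`|W' z.1 z.2| `^ p * \1_B z)%:E.
have mf : measurable_fun setT f.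
  apply/measurable_EFinP; apply: measurable_funM; last exact: measurable_indic.
  by apply: (measurableT_comp (measurable_powR p)); exact: measurableT_comp.
have mg : measurable_fun setT g.
  apply/measurable_EFinP; apply: measurable_funM; last exact: measurable_indic.
  by apply: (measurableT_comp (measurable_powR p)); exact: measurableT_comp.
have f0 z : 0 <= f z by rewrite lee_fin mulr_ge0 ?powR_ge0.
have g0 z : 0 <= g z by rewrite lee_fin mulr_ge0 ?powR_ge0.
have mf1 := measurableT_comp mf mp1.1; have mg2 := measurableT_comp mg mp2.1.
have mD := measurable_L1 m1 m2.
have mDp : measurable_fun setT (fun z : (T * T') * (T * T') =>
    (`|W z.1.1 z.2.1 - W' z.1.2 z.2.2| `^ p)%:E).
  apply/measurable_EFinP; apply: (measurableT_comp (measurable_powR p)).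
  by apply: measurableT_comp => //; exact: measurable_funB.
apply: (@le_trans _ _ ((K `^ (p - 1))%:E *
    L1dist (nu \x nu) (fun z => W z.1.1 z.2.1) (fun z => W' z.1.2 z.2.2) +
    (\int[P \x P]_z f z + \int[P' \x P']_z g z))); last first.
  apply: (@le_trans _ _ ((eta / 2)%:E + ((eta / 4)%:E + (eta / 4)%:E))).
    apply: leeD; last by apply: leeD; exact: ltW.
    rewrite -[X in _ <= X%:E](@divfK _ (K `^ (p - 1))%R) ?gt_eqF// mulrC EFinM.
    by rewrite lee_pmul2l// ltW.
  by rewrite -!EFinD lee_fin; lra.
rewrite -(ge0_integral_mp mp1)// -(ge0_integral_mp mp2)//.
have KD0 (z : (T * T') * (T * T')) : setT z ->
    0 <= (K `^ (p - 1))%:E * (`|W z.1.1 z.2.1 - W' z.1.2 z.2.2|)%:E.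
  by move=> _; rewrite -EFinM lee_fin mulr_ge0// powR_ge0.
rewrite /L1dist -ge0_integralZl_EFin ?powR_ge0// -ge0_integralD//.
have mKD : measurable_fun setT (fun z : (T * T') * (T * T') =>
    (K `^ (p - 1))%:E * (`|W z.1.1 z.2.1 - W' z.1.2 z.2.2|)%:E).
  exact: measurable_funeM.
rewrite -ge0_integralD//; first last.
- exact: emeasurable_funD.
- by move=> z _; exact: adde_ge0.
apply: ge0_le_integral => //.
- by apply: emeasurable_funD => //; exact: emeasurable_funD.
move=> z _; rewrite /f /g -EFinM -!EFinD lee_fin.
have -> : \1_A (z.1.1, z.2.1) = (m%:R < W z.1.1 z.2.1)%R%:R :> R.
  rewrite indicE; congr (_%:R); congr nat_of_bool.
  by apply/idP/idP => [/set_mem//|h]; exact: mem_set.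
have -> : \1_B (z.1.2, z.2.2) = (n%:R < W' z.1.2 z.2.2)%R%:R :> R.
  rewrite indicE; congr (_%:R); congr nat_of_bool.
  by apply/idP/idP => [/set_mem//|h]; exact: mem_set.
exact: powR_dist_le.
Qed.

End distances.

(** * The cycle from cut distance to L^p distance to equivalence and back *)

Theorem theorem2p11 (R : realType) (p : R) (hp : 1 <= p)
    (d d' : measure_display) (T : measurableType d) (T' : measurableType d')
    (P : probability T R) (P' : probability T' R)
    (W : T -> T -> R) (W' : T' -> T' -> R) :
  graphon P W -> graphon P' W' ->
  (Lp_pow P p W < +oo)%E -> (Lp_pow P' p W' < +oo)%E ->
  [<-> delta_cut P P' W W' = 0%E;
       delta_p P P' p W W' = 0%E;
       graphon_equiv P P' W W'].
Proof.
move=> gW gW' WL W'L; tfae.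
(* Each implication extracts L^1-close couplings from its premise and concludes from these. *)
- move=> cut0; apply: delta_p0 => // e e0; exact: coupling_of_cut.
- move=> dp0; apply: equiv_of_couplings => // e e0.
  exact: (L1_of_delta_p gW gW' hp dp0).
- move=> eqW; apply: delta_cut0 => // e e0; exact: coupling_of_equiv.
Qed.
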